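(* There exist at most $13617$ pairs $(r,s)$ with $0<s<r<1$ for which there exists a compact circle-packing $P$ of the plane with $\mathrm{radii}(P)=\{s,r,1\}$. That is, $|\Pi_3|\leq 13617$.
   Context: A circle-packing $P$ is a set of circles in the Euclidean plane such that the open discs bounded by the circles are pairwise disjoint. Put $\mathrm{radii}(P):=\{\mathrm{radius}(S): S\in P\}$. If $\mathrm{radii}(P)$ is finite, $P$ is assumed scaled so that $\max \mathrm{radii}(P)=1$, and $P$ is assumed maximal (with respect to inclusion among compact circle-packings with the same set of radii). A circle-packing $P$ is compact if for every $S\in P$ there exist $m\in\mathbb{N}$ and a maximal indexed set of circles $\{A_0,\ldots,A_{m-1}\}\subseteq P$, called the neighbors of $S$, such that all $A_i$ are tangent to $S$ and, for every $i\in\{0,\ldots,m-1\}$, $A_i$ is tangent to $A_{i+1 \bmod m}$. The neighbors are listed in cyclic order around $S$ and fully surround $S$: the angles at the center of $S$ subtended by the centers of consecutive neighbors $A_i, A_{i+1\bmod m}$ add up to $2\pi$. $\Pi_3$ is the set of all $(r,s)$ with $0<s<r<1$ for which there exists a compact circle-packing $P$ with $\mathrm{radii}(P)=\{s,r,1\}$. *)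

(* Defs.v *)
From mathcomp Require Import all_boot all_order all_algebra.
From mathcomp Require Import all_classical all_reals all_analysis.

Set Implicit Arguments.
Unset Strict Implicit.
Unset Printing Implicit Defensive.

Import Order.TTheory GRing.Theory Num.Theory.

Local Open Scope classical_set_scope.
Local Open Scope ring_scope.

(* Euclidean distance: the library norm on R * R is the max norm, hence the
   explicit formula. *)
Definition edist (R : realType) (x y : R * R) : R :=
  Num.sqrt ((x.1 - y.1) ^+ 2 + (x.2 - y.2) ^+ 2).

(* Unoriented angle at o subtended by x and y, in [0, pi]. *)
Definition angle (R : realType) (o x y : R * R) : R :=
  acos (((x.1 - o.1) * (y.1 - o.1) + (x.2 - o.2) * (y.2 - o.2))
        / (edist o x * edist o y)).

Record circle (R : realType) := Circle {
  center : R * R;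
  radius : R;
  radius_gt0 : 0 < radius
}.

Definition open_disc (R : realType) (C : circle R) : set (R * R) :=
  [set x | edist (center C) x < radius C].

Definition circle_packing (R : realType) (P : set (circle R)) : Prop :=
  trivIset P (@open_disc R).

Definition radii (R : realType) (P : set (circle R)) : set R :=
  @radius R @` P.

(* Only external tangency is considered: distinct circles of a packing cannot
   be internally tangent. *)
Definition tangent (R : realType) (C D : circle R) : Prop :=
  edist (center C) (center D) = radius C + radius D.

(* [ordS i] is i + 1 mod m. *)
Definition tangent_cycle (R : realType) (P : set (circle R)) (S : circle R)
    (m : nat) (A : 'I_m -> circle R) : Prop :=
  [/\ injective A,
      forall i, P (A i),
      forall i, tangent S (A i)
    & forall i, tangent (A i) (A (ordS i))].

(* Maximality compares the underlying sets of circles. *)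
Definition maximal_tangent_cycle (R : realType) (P : set (circle R))
    (S : circle R) (m : nat) (A : 'I_m -> circle R) : Prop :=
  tangent_cycle P S A /\
  forall (n : nat) (B : 'I_n -> circle R),
    tangent_cycle P S B -> range A `<=` range B -> range B = range A.

(* The t i are polar angles around the center of S: the centers of the A i are
   met in the order of their indices during one counterclockwise turn. *)
Definition cyclically_ordered (R : realType) (S : circle R)
    (m : nat) (A : 'I_m -> circle R) : Prop :=
  exists t : 'I_m -> R,
    (forall i, let d := edist (center S) (center (A i)) in
       center (A i) = ((center S).1 + d * cos (t i),
                       (center S).2 + d * sin (t i))) /\
    (forall i j : 'I_m, (i < j)%N -> t i < t j < t i + 2 * pi).

Definition surrounds (R : realType) (S : circle R)
    (m : nat) (A : 'I_m -> circle R) : Prop :=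
  \sum_(i < m) angle (center S) (center (A i)) (center (A (ordS i))) = 2 * pi.

Definition neighbors (R : realType) (P : set (circle R)) (S : circle R)
    (m : nat) (A : 'I_m -> circle R) : Prop :=
  [/\ maximal_tangent_cycle P S A, cyclically_ordered S A & surrounds S A].

Definition compact_packing (R : realType) (P : set (circle R)) : Prop :=
  circle_packing P /\
  forall S, P S -> exists (m : nat) (A : 'I_m -> circle R), neighbors P S A.

Definition maximal_compact_packing (R : realType) (P : set (circle R)) : Prop :=
  compact_packing P /\
  forall Q : set (circle R),
    compact_packing Q -> radii Q = radii P -> P `<=` Q -> Q = P.

(* Elements are pairs (r, s) with the larger radius first. Packings with
   finitely many radii are, by convention, maximal and scaled so that the
   largest radius is 1. *)
Definition Pi3 (R : realType) : set (R * R) :=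
  [set rs : R * R | let: (r, s) := rs in
    [/\ 0 < s, s < r, r < 1 &
      exists P : set (circle R),
        maximal_compact_packing P /\ radii P = [set s; r; 1]]].

Arguments Pi3 : clear implicits.

(* Main.v *)
Require Import Defs.
From mathcomp Require Import all_boot all_order all_algebra.
From mathcomp Require Import all_classical all_reals all_analysis.
From mathcomp Require Import ring lra zify.
Import Defs.

(* Walking around a circle of a packing with radii s < r < 1, the radii of its
   neighbors form a closed word in the letters s, r, 1, and the angle equation
   at that circle only depends on the number of occurrences of each unordered
   pair of consecutive letters: the code of the circle.

   One code c of an s-circle (not all s) and one code k of an r-circle (not
   all r), at least one of them containing the letter 1, determine (r, s).
   Indeed, compare two solutions and look at the letter whose radius grows by
   the largest factor: the contact angles around it can only decrease, so all
   its neighbors grow by the same factor, and this spreads to the letter 1.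

   Such codes exist. If the neighbors of the circles of a family were always in
   the family, then from any circle of the family one could step to a neighbor
   having a smaller power with respect to the center of a fixed larger circle
   outside of the family, by a definite amount each time. Moreover a circle
   tangent to S and at least as large as S is a neighbor of S, because it does
   not fit between two tangent neighbors; this links the choices of c and k.

   It remains to count. At the s-circle the angles are at least pi / 3, and not
   all equal to it, so c has at most five letters, and there are 55 candidates. The code c bounds s / r from
   below, which bounds the contact angles at the r-circle from below, and thus
   bounds k. *)

Set Implicit Arguments.
Unset Strict Implicit.
Unset Printing Implicit Defensive.

Import Order.TTheory GRing.Theory Num.Theory.

(** * Codes *)

Fixpoint knapsack (ws : seq nat) (W : nat) : seq (seq nat) :=
  if ws is w :: ws' then
    [seq n :: v | n <- iota 0 (W %/ w).+1, v <- knapsack ws' (W - n * w)]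
  else [:: [::]].

Definition weight (ws v : seq nat) : nat := sumn [seq p.1 * p.2 | p <- zip v ws].

(** Completeness of the enumeration, the direction that an upper bound on the number of codes calls
    for. *)
Lemma mem_knapsack (ws v : seq nat) (W : nat) :
  all (leq 1) ws -> size v = size ws -> weight ws v <= W -> v \in knapsack ws W.
Proof.
elim: ws v W => [|w ws IH] [|n v] W //.
rewrite [all _ _]/= => /andP[w0 ws0] [sz] le_W.
have {}le_W : n * w + weight ws v <= W := le_W.
apply/allpairsPdep; exists n, v; split => //.
  by rewrite mem_iota ltnS leq_divRL // (leq_trans _ le_W) // leq_addr.
by apply: IH => //; rewrite leq_subRL // (leq_trans _ le_W) // leq_addr.
Qed.

Lemma weightE (ws v : seq nat) (n : nat) : size v = n -> size ws = n ->
  weight ws v = \sum_(i < n) nth 0 v i * nth 0 ws i.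
Proof.
elim: n ws v => [|n IH] [|w ws] [|k v] //; first by rewrite big_ord0.
by case=> sv [sw]; rewrite big_ord_recl -(IH ws v).
Qed.

(* Codes list the numbers of consecutive pairs ss, sr, s1, rr, r1, 11, in this
   order; o stands for the letter 1. The conditions are those for the pairs to be
   the edges of a closed walk on the letters: even degrees and connectedness. *)
Definition closed_code (v : seq nat) : bool :=
  if v is [:: ss; sr; so; rr; ro; oo] then
    [&& ~~ odd (sr + so), ~~ odd (sr + ro), ~~ odd (so + ro),
        (sr + so == 0) ==> (ss == 0) || (rr + ro + oo == 0),
        (sr + ro == 0) ==> (rr == 0) || (ss + so + oo == 0)
      & (so + ro == 0) ==> (oo == 0) || (ss + sr + rr == 0)]
  else false.

Definition has_s (v : seq nat) : bool :=
  if v is [:: ss; sr; so; rr; ro; oo] then 0 < ss + sr + so else false.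
Definition has_r (v : seq nat) : bool :=
  if v is [:: ss; sr; so; rr; ro; oo] then 0 < sr + rr + ro else false.
Definition has_1 (v : seq nat) : bool :=
  if v is [:: ss; sr; so; rr; ro; oo] then 0 < so + ro + oo else false.

(* At an s-circle a pair spans at least pi / 3, with equality for ss only. It
   spans at most pi / 3 if it is ss, less than pi / 2 if it contains s once and
   less than pi otherwise; the weights are these bounds in units of pi / 6. *)
Definition small_code (v : seq nat) : bool :=
  [&& closed_code v, has_r v || has_1 v & 12 < weight [:: 2; 3; 3; 6; 6; 6] v].

Definition small_codes : seq (seq nat) :=
  [seq v <- knapsack (nseq 6 1) 5 | small_code v].

(* Lower bounds, in units of pi / 24, for the angles at an r-circle spanned by
   the pairs ss and sr. They only depend on c with 1 replaced by r, which
   minimizes s / r. *)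
Definition angle_bounds (v : seq nat) : nat * nat :=
  if v is [:: ss; sr; so; rr; ro; oo] then
    let c := (ss, sr + so, rr + ro + oo) in
    if c == (1, 2, 1) then (1, 3)
    else if c == (0, 0, 3) then (2, 4)
    else if c \in [:: (0, 2, 2); (1, 4, 0); (2, 2, 1); (0, 0, 4)] then (3, 5)
    else (4, 6)
  else (1, 3).

(* At an r-circle, in units of pi / 24, the weights bound the angles of all pairs
   from above, and in medium_codes from below; the lower bounds for the pairs
   containing 1 are strict. *)
Definition medium_code (v : seq nat) : bool :=
  [&& closed_code v, has_s v || has_1 v & 48 < weight [:: 8; 8; 12; 8; 12; 24] v].

Definition medium_codes (f g : nat) : seq (seq nat) :=
  let ws := [:: f; g; g; 8; 8; 8] in
  [seq v <- knapsack ws 48 | medium_code v && (has_1 v ==> (weight ws v < 48))].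

(* If k contains 1, then c is chosen at an s-circle in the corona coded by k, next
   to a 1-circle when possible. Otherwise no corona of an r-circle contains 1, so
   the pair r1 does not occur in c. *)
Definition compatible (c k : seq nat) : bool :=
  if has_1 k then
    (has_s k ==> has_r c) && ((0 < nth 0 k 2) ==> has_1 c)
  else has_1 c && (nth 0 c 4 == 0).

Definition code_pairs : seq (seq nat * seq nat) :=
  [seq (c, k) | c <- small_codes,
     k <- [seq k <- medium_codes (angle_bounds c).1 (angle_bounds c).2
          | compatible c k]].

Local Open Scope classical_set_scope.
Local Open Scope ring_scope.
Local Open Scope card_scope.

(** * Contact angles *)

Section Trigonometry.
Context {R : realType}.
Implicit Types x y : R.

(** Beyond pi the bound is clear, as [acos] is at most pi; this matters for gaps of polar angles,
    which may exceed pi. *)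
Lemma acos_cos_le x : 0 <= x -> acos (cos x) <= x.
Proof.
move=> x0; have [x_pi|pi_x] := leP x pi.
  by rewrite cosK // in_itv /= x0.
by rewrite (le_trans _ (ltW pi_x)) // acos_lepi // cos_geN1 cos_le1.
Qed.

Lemma cos_le_cos x y : 0 <= x <= pi -> 0 <= y <= pi -> (cos x <= cos y) = (y <= x).
Proof. by move=> x_itv y_itv; rewrite leNgt ltr_cos -?leNgt ?in_itv. Qed.

Lemma cos_lt_cos x y : 0 <= x <= pi -> 0 <= y <= pi -> (cos x < cos y) = (y < x).
Proof. by move=> x_itv y_itv; rewrite ltr_cos ?in_itv. Qed.

Lemma acos_le_acos x y : -1 <= x <= 1 -> -1 <= y <= 1 -> (acos x <= acos y) = (y <= x).
Proof.
move=> x1 y1; rewrite -cos_le_cos ?acosK ?in_itv //=;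
  by rewrite ?acos_ge0 ?acos_lepi.
Qed.

Lemma acos_le_cos x y : -1 <= x <= 1 -> 0 <= y -> cos y <= x -> acos x <= y.
Proof.
move=> x1 y0 cos_y; apply: le_trans (acos_cos_le y0).
by rewrite acos_le_acos // cos_geN1 cos_le1.
Qed.

Lemma cos_double x : cos (2 * x) = 2 * cos x ^+ 2 - 1 :> R.
Proof. by rewrite mulr_natl cos_mulr2n mulr_natl. Qed.

Lemma cos_pi3 : cos (pi / 3) = 1 / 2 :> R.
Proof.
have pi0 := pi_gt0 R.
have c0 : 0 < cos (pi / 3 : R) by apply: cos_gt0_pihalf; lra.
have : cos (2 * (pi / 3)) = - cos (pi / 3) :> R.
  rewrite (_ : 2 * (pi / 3) = pi - pi / 3); last by lra.
  by rewrite addrC cosDpi cosN.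
rewrite cos_double => H.
(* With c = cos (pi / 3), doubling gives 2 c^2 + c - 1 = 0, factored here. *)
have /eqP : (2 * cos (pi / 3 : R) - 1) * (cos (pi / 3 : R) + 1) = 0 by lra.
by rewrite mulf_eq0 => /orP[] /eqP; lra.
Qed.

Lemma polar_coordinates x y : x ^+ 2 + y ^+ 2 = 1 ->
  exists t : R, [/\ 0 <= t, t < 2 * pi, x = cos t & y = sin t].
Proof.
move=> xy1; have x1 : -1 <= x <= 1 by nra.
have pi0 := pi_gt0 R.
have cosx : cos (acos x) = x by rewrite acosK.
have sinx : sin (acos x) ^+ 2 = y ^+ 2 by rewrite sin2cos2 cosx -xy1; ring.
have sin_ge0 : 0 <= sin (acos x) by apply: sin_ge0_pi; rewrite acos_ge0 ?acos_lepi.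
have [y0|y0] := leP 0 y.
  exists (acos x); split => //; first by rewrite acos_ge0.
    by rewrite (@le_lt_trans _ _ pi) ?acos_lepi //; lra.
  by apply/eqP; rewrite -(@eqrXn2 _ 2) // sinx.
have acos0 : 0 < acos x.
  rewrite lt_neqAle acos_ge0 // andbT; apply/eqP => x0.
  by move: sinx; rewrite -x0 sin0 expr0n /=; nra.
have E : 2 * pi - acos x = - acos x + pi *+ 2 :> R by rewrite -mulr_natl; ring.
exists (2 * pi - acos x); split.
- by rewrite subr_ge0 (le_trans (acos_lepi x1)) //; lra.
- by lra.
- by rewrite E cosD2pi cosN.
rewrite E sinD2pi sinN.
apply/eqP; rewrite -eqr_oppLR -(@eqrXn2 _ 2) ?sinx ?sqrrN //; lra.
Qed.

(** By the law of cosines, the angle at the center of the circle of radius [o] in the triangle of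
    centers of three mutually tangent circles. The ratios make its monotonicity in [x / o] and
    [y / o] visible. *)
Definition contact_angle (o x y : R) : R :=
  acos (1 - 2 * (x / (o + x)) * (y / (o + y))).

Lemma ratio_itv (o x : R) : 0 < o -> 0 < x -> 0 < x / (o + x) < 1.
Proof.
move=> o0 x0; rewrite divr_gt0 ?addr_gt0 //= ltr_pdivrMr ?addr_gt0 //; lra.
Qed.

Lemma contact_arg (p q : R) : 0 < p < 1 -> 0 < q < 1 -> -1 < 1 - 2 * p * q < 1.
Proof.
move=> /andP[p0 p1] /andP[q0 q1].
have pq0 : 0 < p * q by nra.
have pq1 : p * q < 1 by nra.
nra.
Qed.

Section ContactAngle.
Variables (o x y : R).
Hypotheses (o0 : 0 < o) (x0 : 0 < x) (y0 : 0 < y).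

Let arg : -1 < 1 - 2 * (x / (o + x)) * (y / (o + y)) < 1.
Proof. by apply: contact_arg; apply: ratio_itv. Qed.

Lemma cos_contact_angle :
  cos (contact_angle o x y) = 1 - 2 * (x / (o + x)) * (y / (o + y)).
Proof. by case/andP: arg => a1 a2; rewrite acosK // in_itv /= !ltW. Qed.

Lemma contact_angle_gt0 : 0 < contact_angle o x y.
Proof. by apply: acos_gt0; case/andP: arg => /ltW-> ->. Qed.

Lemma contact_angle_ltpi : contact_angle o x y < pi.
Proof. by apply: acos_ltpi; case/andP: arg => -> /ltW->. Qed.

Lemma contact_angle_le (t : R) : 0 <= t ->
  cos t <= 1 - 2 * (x / (o + x)) * (y / (o + y)) -> contact_angle o x y <= t.
Proof. by case/andP: arg => a1 a2 t0; apply: acos_le_cos; rewrite // !ltW. Qed.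

End ContactAngle.

Lemma contact_angleC (o x y : R) : contact_angle o x y = contact_angle o y x.
Proof. by rewrite /contact_angle mulrAC. Qed.

Lemma ratio_le (o o' x x' : R) : 0 < o -> 0 < o' -> 0 < x -> 0 < x' ->
  (x' / (o' + x') <= x / (o + x)) = (x' * o <= x * o').
Proof.
move=> *; rewrite ler_pdivrMr ?addr_gt0 // mulrAC ler_pdivlMr ?addr_gt0 //.
by apply/idP/idP; nra.
Qed.

Section ContactAngleMonotone.
Variables (o x y o' x' y' : R).
Hypotheses (o0 : 0 < o) (x0 : 0 < x) (y0 : 0 < y).
Hypotheses (o'0 : 0 < o') (x'0 : 0 < x') (y'0 : 0 < y').
Hypotheses (hx : x' * o <= x * o') (hy : y' * o <= y * o').

Lemma contact_angle_mono : contact_angle o' x' y' <= contact_angle o x y.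
Proof.
have /andP[p0 p1] := ratio_itv o0 x0; have /andP[q0 q1] := ratio_itv o0 y0.
have /andP[p'0 p'1] := ratio_itv o'0 x'0; have /andP[q'0 q'1] := ratio_itv o'0 y'0.
have := hx; rewrite -ratio_le // => hp; have := hy; rewrite -ratio_le // => hq.
have hpq := ler_pM (ltW p'0) (ltW q'0) hp hq.
rewrite contact_angle_le ?(ltW (contact_angle_gt0 _ _ _)) // cos_contact_angle //.
lra.
Qed.

Lemma contact_angle_mono_lt : (x' * o < x * o') || (y' * o < y * o') ->
  contact_angle o' x' y' < contact_angle o x y.
Proof.
have /andP[p0 p1] := ratio_itv o0 x0; have /andP[q0 q1] := ratio_itv o0 y0.
have /andP[p'0 p'1] := ratio_itv o'0 x'0; have /andP[q'0 q'1] := ratio_itv o'0 y'0.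
have := hx; rewrite -ratio_le // => hp; have := hy; rewrite -ratio_le // => hq.
move=> H; have hpq : x' / (o' + x') * (y' / (o' + y')) < x / (o + x) * (y / (o + y)).
  case/orP: H; rewrite ltNge -ratio_le // -ltNge => H.
    by rewrite (@le_lt_trans _ _ (x' / (o' + x') * (y / (o + y)))) ?ler_wpM2l ?ltr_pM2r // ltW.
  by rewrite (@le_lt_trans _ _ (x / (o + x) * (y' / (o' + y')))) ?ler_wpM2r ?ltr_pM2l // ltW.
rewrite -cos_lt_cos ?contact_angle_gt0 ?(ltW (contact_angle_gt0 _ _ _)) ?(ltW (contact_angle_ltpi _ _ _)) //.
rewrite !cos_contact_angle //; lra.
Qed.

End ContactAngleMonotone.

Lemma contact_angle_id (o : R) : 0 < o -> contact_angle o o o = pi / 3.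
Proof.
move=> o0; have pi0 := pi_gt0 R.
rewrite /contact_angle (_ : 1 - _ = cos (pi / 3)); last by rewrite cos_pi3; field; lra.
by rewrite cosK // in_itv /=; lra.
Qed.

Lemma contact_angle_lt_pihalf (o x : R) : 0 < o -> 0 < x ->
  contact_angle o o x < pi / 2.
Proof.
move=> o0 x0; have /andP[q0 q1] := ratio_itv o0 x0; have pi0 := pi_gt0 R.
rewrite -cos_lt_cos ?(ltW (contact_angle_gt0 _ _ _)) ?(ltW (contact_angle_ltpi _ _ _)) //; last by lra.
rewrite cos_pihalf cos_contact_angle // (_ : o / (o + o) = 1 / 2); first by lra.
by field; lra.
Qed.

(* Equivalently, the circle inscribed in the interstice of three mutually tangent
   circles is smaller than each of them. *)
Lemma contact_angle_interstice (o x y : R) : 0 < o -> 0 < x -> 0 < y ->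
  contact_angle o x y < contact_angle o x o + contact_angle o o y.
Proof.
move=> o0 x0 y0.
have /andP[p0 p1] := ratio_itv o0 x0; have /andP[q0 q1] := ratio_itv o0 y0.
set p := x / (o + x) in p0 p1; set q := y / (o + y) in q0 q1.
have half : o / (o + o) = 1 / 2 by field; lra.
have cosA : cos (contact_angle o x o) = 1 - p by rewrite cos_contact_angle // half -/p; field.
have cosB : cos (contact_angle o o y) = 1 - q by rewrite cos_contact_angle // half -/q; field.
have pi0 := pi_gt0 R.
have A0 := contact_angle_gt0 o0 x0 o0; have B0 := contact_angle_gt0 o0 o0 y0.
have Api := contact_angle_ltpi o0 x0 o0; have Bpi := contact_angle_ltpi o0 o0 y0.
have A2 : contact_angle o x o < pi / 2 by rewrite contact_angleC contact_angle_lt_pihalf.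
have B2 := contact_angle_lt_pihalf o0 y0.
rewrite -cos_lt_cos ?(ltW (contact_angle_gt0 _ _ _)) ?(ltW (contact_angle_ltpi _ _ _)) //; last by lra.
rewrite cos_contact_angle // -/p -/q cosD cosA cosB.
have sA : 0 < sin (contact_angle o x o) by apply: sin_gt0_pi; rewrite A0.
have sB : 0 < sin (contact_angle o o y) by apply: sin_gt0_pi; rewrite B0.
have sA2 : sin (contact_angle o x o) ^+ 2 = p * (2 - p) by rewrite sin2cos2 cosA; ring.
have sB2 : sin (contact_angle o o y) ^+ 2 = q * (2 - q) by rewrite sin2cos2 cosB; ring.
have S2 : (sin (contact_angle o x o) * sin (contact_angle o o y)) ^+ 2 = p * (2 - p) * (q * (2 - q)).
  by rewrite exprMn sA2 sB2.
have S0 : 0 < sin (contact_angle o x o) * sin (contact_angle o o y) by rewrite mulr_gt0.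
move: (_ * sin _) S2 S0 => S S2 S0.
(* By the addition formula the goal is T < S with T = 3pq - p - q. If T > 0, then T < pq because 2pq
   < p + q, so T^2 < (pq)^2 < pq < pq(2 - p)(2 - q) = S^2. *)
have [|T0] := leP (3 * (p * q) - p - q) 0; first by nra.
have pq0 : 0 < p * q by nra.
suff : (3 * (p * q) - p - q) ^+ 2 < S ^+ 2.
  by rewrite ltr_sqr ?nnegrE ?(ltW T0) ?(ltW S0) //; lra.
rewrite S2.
have -> : p * (2 - p) * (q * (2 - q)) = p * q * ((2 - p) * (2 - q)) by ring.
have h1 : 3 * (p * q) - p - q < p * q by nra.
have h2 : 1 < (2 - p) * (2 - q) by nra.
have h3 : (3 * (p * q) - p - q) ^+ 2 < (p * q) ^+ 2 by rewrite ltr_sqr ?nnegrE ?ltW.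
have pq1 : p * q < 1 by nra.
nra.
Qed.

End Trigonometry.

(** * Lower bounds for the angles at an r-circle, in ticks of pi / 24 *)

Section ApexAngleBounds.
Context {R : realType}.

Local Notation tick := (pi / 24 : R).

Lemma cos_halve (x lo hi : R) : 0 <= cos (x / 2) -> 0 <= lo -> 0 <= hi ->
  2 * lo ^+ 2 - 1 <= cos x <= 2 * hi ^+ 2 - 1 -> lo <= cos (x / 2) <= hi.
Proof.
move=> c0 lo0 hi0.
have -> : cos x = 2 * cos (x / 2) ^+ 2 - 1 by rewrite -cos_double; congr cos; lra.
move=> H; rewrite -[X in X && _]ler_sqr // -[X in _ && X]ler_sqr //.
lra.
Qed.

Lemma cos_tick_ge0 (k : R) : 0 <= k <= 12 -> 0 <= cos (k * tick).
Proof. by move=> kP; apply: cos_ge0_pihalf; have pi0 := pi_gt0 R; nra. Qed.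

(** Half-angle formulas, started from the exact cosines at 8 and 12 ticks and from 20 = 24 - 4
    ticks. The rational bounds are precise enough for [curve_ticks]. *)
Lemma cos_ticks :
  [/\ 99 / 100 <= cos (1 * tick) <= 1,
      28 / 29 <= cos (2 * tick) <= 29 / 30,
      12 / 13 <= cos (3 * tick) <= 13 / 14 &
  [/\ 32 / 37 <= cos (4 * tick) <= 13 / 15,
      11 / 14 <= cos (5 * tick) <= 4 / 5 &
      12 / 17 <= cos (6 * tick) <= 5 / 7]].
Proof.
have halve (k l lo hi : R) : k = 2 * l -> 0 <= l <= 12 -> 0 <= lo -> 0 <= hi ->
    2 * lo ^+ 2 - 1 <= cos (k * tick) <= 2 * hi ^+ 2 - 1 ->
    lo <= cos (l * tick) <= hi.
  move=> kl lP lo0 hi0 H; have E : l * tick = k * tick / 2 by rewrite kl; lra.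
  by rewrite E; apply: cos_halve => //; rewrite -E cos_tick_ge0.
have c8 : cos (8 * tick) = 1 / 2 by rewrite -cos_pi3; congr cos; lra.
have c12 : cos (12 * tick) = 0 by rewrite (_ : 12 * tick = pi / 2) ?cos_pihalf //; lra.
have c4 : 32 / 37 <= cos (4 * tick) <= 13 / 15.
  by apply: (halve 8); rewrite ?c8; clear; lra.
have c6 : 12 / 17 <= cos (6 * tick) <= 5 / 7.
  by apply: (halve 12); rewrite ?c12; clear; lra.
have c20 : cos (20 * tick) = - cos (4 * tick).
  rewrite (_ : 20 * tick = - (4 * tick) + pi); last by lra.
  by rewrite cosDpi cosN.
have c10 : 1 / 4 <= cos (10 * tick) <= 4 / 15.
  by apply: (halve 20); rewrite ?c20; move: c4; clear; lra.
have c5 : 11 / 14 <= cos (5 * tick) <= 4 / 5.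
  by apply: (halve 10); move: c10; clear; lra.
have c2 : 28 / 29 <= cos (2 * tick) <= 29 / 30.
  by apply: (halve 4); move: c4; clear; lra.
have c3 : 12 / 13 <= cos (3 * tick) <= 13 / 14.
  by apply: (halve 6); move: c6; clear; lra.
have c1 : 99 / 100 <= cos (1 * tick) <= 1.
  by apply: (halve 2); move: c2; clear; lra.
by split; [| | | split].
Qed.

(** The angles f and g of the next section satisfy 1 - cos f = 2 (1 - cos g)^2, an increasing curve.
    Thus [q l <= p k] turns g < l ticks into f < k ticks, and [p k <= q l] turns f < k ticks into g
    < l ticks. *)
Lemma curve_ticks (p : R -> R := fun k => 1 - cos (k * tick))
    (q : R -> R := fun k => 2 * (1 - cos (k * tick)) ^+ 2) :
  [/\ q 3 <= p 2, q 5 <= p 4, q 6 <= p 6 &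
  [/\ p 1 <= q 3, p 2 <= q 4, p 3 <= q 5 & p 4 <= q 6]].
Proof.
rewrite /p /q; have [c1 c2 c3 [c4 c5 c6]] := cos_ticks.
split; [| | | split].
- by move: c2 c3; clear; nra.
- by move: c4 c5; clear; nra.
- by move: c6; clear; nra.
- by move: c1 c3; clear; nra.
- by move: c2 c4; clear; nra.
- by move: c3 c5; clear; nra.
- by move: c4 c6; clear; nra.
Qed.

Section ApexAngles.
Variables s r : R.
Hypotheses (s0 : 0 < s) (sr : s < r).

Let r0 : 0 < r. Proof. exact: lt_trans sr. Qed.

Let y : R := s / (s + r).

Let yP : 0 < y < 1 / 2.
Proof. by rewrite divr_gt0 ?addr_gt0 //= ltr_pdivrMr ?addr_gt0 //; have := sr; lra. Qed.

Local Notation f := (contact_angle r s s).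
Local Notation g := (contact_angle r r s).

Let fP : 0 < f < pi. Proof. by rewrite contact_angle_gt0 ?contact_angle_ltpi. Qed.
Let gP : 0 < g < pi. Proof. by rewrite contact_angle_gt0 ?contact_angle_ltpi. Qed.

Let cosf : cos f = 1 - 2 * y ^+ 2.
Proof. by rewrite cos_contact_angle // /y [s + r]addrC; ring. Qed.

Let cosg : cos g = 1 - y.
Proof. by rewrite cos_contact_angle // /y [s + r]addrC; field; have := r0; have := s0; lra. Qed.

(* The angles add up to pi in the isosceles triangles with sides 2s, s + r, s + r
   and 2r, s + r, s + r. *)
Lemma apex_angle_ssr : contact_angle s s r = (pi - f) / 2.
Proof.
have /andP[f0 fpi] := fP.
rewrite /contact_angle.
rewrite (_ : 1 - _ = cos ((pi - f) / 2)).
  by rewrite cosK // in_itv /=; lra.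
have c0 : 0 <= cos ((pi - f) / 2) by apply: cos_ge0_pihalf; lra.
have : cos (2 * ((pi - f) / 2)) = - cos f.
  by rewrite (_ : 2 * _ = - f + pi) ?cosDpi ?cosN //; lra.
rewrite cos_double cosf => H.
have -> : 1 - 2 * (s / (s + s)) * (r / (s + r)) = y.
  by rewrite /y; field; have := r0; have := s0; lra.
have /andP[y0 _] := yP.
by apply/eqP; rewrite -(@eqrXn2 _ 2) ?(ltW y0) //; apply/eqP; lra.
Qed.

Lemma apex_angle_srr : contact_angle s r r = pi - 2 * g.
Proof.
have /andP[g0 gpi] := gP; have /andP[y0 y1] := yP.
have g2 : g < pi / 2.
  by rewrite -cos_lt_cos ?cos_pihalf ?cosg ?ltW //; lra.
rewrite /contact_angle (_ : 1 - _ = cos (pi - 2 * g)).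
  by rewrite cosK // in_itv /=; lra.
rewrite [pi - _]addrC cosDpi cosN cos_double cosg /y.
by field; have := r0; have := s0; lra.
Qed.

(* Both angles are increasing in y, and 1 - cos f = 2 (1 - cos g)^2. *)
Lemma apex_angles_lt_gf (F G : R) : 0 <= F <= pi -> 0 <= G <= pi -> g < G ->
  2 * (1 - cos G) ^+ 2 <= 1 - cos F -> f < F.
Proof.
move=> FP GP; have /andP[g0 gpi] := gP; have /andP[f0 fpi] := fP.
have /andP[y0 _] := yP.
rewrite -cos_lt_cos ?cosg ?(ltW g0) ?(ltW gpi) // => gG H.
rewrite -cos_lt_cos ?cosf ?(ltW f0) ?(ltW fpi) //.
nra.
Qed.

Lemma apex_angles_lt_fg (F G : R) : 0 <= F <= pi -> 0 <= G <= pi -> f < F ->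
  1 - cos F <= 2 * (1 - cos G) ^+ 2 -> g < G.
Proof.
move=> FP GP; have /andP[g0 gpi] := gP; have /andP[f0 fpi] := fP.
have /andP[y0 _] := yP.
rewrite -cos_lt_cos ?cosf ?(ltW f0) ?(ltW fpi) // => fF H.
rewrite -cos_lt_cos ?cosg ?(ltW g0) ?(ltW gpi) //.
have := cos_le1 G; nra.
Qed.

(** Here [a], [b], [d] count the pairs ss, sr, rr at an s-circle. The inequality bounds b f / 2 + 2
    d g from below; if f or g were below its bound, the curve would bound the other one as well, and
    the combination would be too small. *)
Lemma apex_angle_bounds (a b d : nat) :
  (a, b, d) \in [:: (1, 2, 1); (0, 0, 3); (0, 2, 2); (1, 4, 0); (2, 2, 1);
    (0, 0, 4); (0, 4, 1); (1, 2, 2); (0, 2, 3); (0, 0, 5)]%N ->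
  a%:R * (pi / 3) + b%:R * ((pi - f) / 2) + d%:R * (pi - 2 * g) <= 2 * pi ->
  let bd := if (a, b, d) == (1, 2, 1)%N then (1, 3)%N
    else if (a, b, d) == (0, 0, 3)%N then (2, 4)%N
    else if (a, b, d) \in [:: (0, 2, 2); (1, 4, 0); (2, 2, 1); (0, 0, 4)]%N
      then (3, 5)%N
    else (4, 6)%N in
  bd.1%:R * tick <= f /\ bd.2%:R * tick <= g.
Proof.
have [q3 q5 q6 [p1 p2 p3 p4]] := curve_ticks; have pi0 := pi_gt0 R.
have itv (k : nat) : (k <= 24)%N -> 0 <= k%:R * tick <= pi.
  rewrite -(ler_nat R) => k24; have := ler0n R k => k0; nra.
have gf3 : g < 3 * tick -> f < 2 * tick.
  by move=> h; apply: (apex_angles_lt_gf (itv 2 isT) (itv 3 isT) h q3).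
have fg1 : f < 1 * tick -> g < 3 * tick.
  by move=> h; apply: (apex_angles_lt_fg (itv 1 isT) (itv 3 isT) h p1).
have fg2 : f < 2 * tick -> g < 4 * tick.
  by move=> h; apply: (apex_angles_lt_fg (itv 2 isT) (itv 4 isT) h p2).
have gf5 : g < 5 * tick -> f < 4 * tick.
  by move=> h; apply: (apex_angles_lt_gf (itv 4 isT) (itv 5 isT) h q5).
have fg3 : f < 3 * tick -> g < 5 * tick.
  by move=> h; apply: (apex_angles_lt_fg (itv 3 isT) (itv 5 isT) h p3).
have gf6 : g < 6 * tick -> f < 6 * tick.
  by move=> h; apply: (apex_angles_lt_gf (itv 6 isT) (itv 6 isT) h q6).
have fg4 : f < 4 * tick -> g < 6 * tick.
  by move=> h; apply: (apex_angles_lt_fg (itv 4 isT) (itv 6 isT) h p4).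
move=> {q3 q5 q6 p1 p2 p3 p4 itv} abd H.
have X (k l : R) : (f < k * tick -> False) -> (g < l * tick -> False) -> k * tick <= f /\ l * tick <= g.
  by move=> hk hl; rewrite !leNgt; split; apply/negP.
move: abd; rewrite !inE => /orP[|/orP[|/orP[|/orP[|/orP[|/orP[|/orP[|/orP[|/orP[|]]]]]]]]] /eqP E;
  move: H; case: E => -> -> -> H /=; apply: X.
- by move=> /[dup] /fg1; lra.
- by move=> /[dup] /gf3; lra.
- by move=> /[dup] /fg2; lra.
- by lra.
- by move=> /[dup] /fg3; lra.
- by move=> /[dup] /gf5; lra.
- by move=> /[dup] /fg3; lra.
- by move=> /[dup] /gf5; lra.
- by move=> /[dup] /fg3; lra.
- by move=> /[dup] /gf5; lra.
- by move=> /[dup] /fg3; lra.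
- by move=> /[dup] /gf5; lra.
- by move=> /[dup] /fg4; lra.
- by move=> /[dup] /gf6; lra.
- by move=> /[dup] /fg4; lra.
- by move=> /[dup] /gf6; lra.
- by move=> /[dup] /fg4; lra.
- by move=> /[dup] /gf6; lra.
- by move=> /[dup] /fg4; lra.
- by move=> /[dup] /gf6; lra.
Qed.

End ApexAngles.

End ApexAngleBounds.

(** * Angle equations restrict the codes *)

Section CodeBounds.
Context {R : realType}.
Local Notation tick := (pi / 24 : R).

Definition code_sum (v : seq nat) (F : nat -> R) : R :=
  \sum_(i < 6) (nth 0%N v i)%:R * F i.

Lemma code_sum_le (v : seq nat) (F G : nat -> R) :
  (forall i, (i < 6)%N -> F i <= G i) -> code_sum v F <= code_sum v G.
Proof. by move=> FG; apply: ler_sum => i _; rewrite ler_wpM2l ?FG. Qed.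

(** The nonnegative terms v_i (G_i - F_i) add up to at most 0, so they all vanish. This equality
    case gives both the strict bounds on codes and the rigidity of the radii. *)
Lemma code_sum_tight (v : seq nat) (F G : nat -> R) :
  (forall i, (i < 6)%N -> F i <= G i) -> code_sum v G <= code_sum v F ->
  forall i, (i < 6)%N -> F i < G i -> nth 0%N v i = 0%N.
Proof.
move=> FG GF i i6 FGi.
have : \sum_(j < 6) (nth 0%N v j)%:R * (G j - F j) = 0.
  apply/le_anti/andP; split; last by apply: sumr_ge0 => j _; rewrite mulr_ge0 ?subr_ge0 ?FG.
  rewrite (eq_bigr (fun j : 'I_6 => (nth 0%N v j)%:R * G j - (nth 0%N v j)%:R * F j)).
    by rewrite big_split /= sumrN subr_le0.
  by move=> j _; rewrite mulrBr.
move=> /eqP; rewrite psumr_eq0; last by move=> j _; rewrite mulr_ge0 ?subr_ge0 ?FG.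
move=> /allP /(_ (Ordinal i6)); rewrite mem_index_enum => /(_ isT) /=.
by rewrite mulf_eq0 subr_eq0 (gt_eqF FGi) orbF pnatr_eq0 => /eqP.
Qed.

Lemma code_sum_weight (v ws : seq nat) (u : R) : size v = 6 -> size ws = 6 ->
  code_sum v (fun i => (nth 0%N ws i)%:R * u) = (weight ws v)%:R * u.
Proof.
move=> sv sw; rewrite (weightE sv sw) natr_sum mulr_suml; apply: eq_bigr => i _.
by rewrite natrM mulrA.
Qed.

Definition edge_angle (o a b c : R) (i : nat) : R :=
  nth 0 [:: contact_angle o a a; contact_angle o a b; contact_angle o a c;
    contact_angle o b b; contact_angle o b c; contact_angle o c c] i.

Definition angle_sum (o a b c : R) (v : seq nat) : R :=
  code_sum v (edge_angle o a b c).

Lemma size_closed_code (v : seq nat) : closed_code v -> size v = 6.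
Proof. by case: v => [|? [|? [|? [|? [|? [|? [|]]]]]]]. Qed.

Lemma has_1E (v : seq nat) : size v = 6 ->
  has_1 v = ~~ [&& nth 0 v 2 == 0, nth 0 v 4 == 0 & nth 0 v 5 == 0]%N.
Proof. by case: v => [|? [|? [|? [|? [|? [|? [|]]]]]]] //= _; lia. Qed.

Lemma has_rE (v : seq nat) : size v = 6 ->
  has_r v = ~~ [&& nth 0 v 1 == 0, nth 0 v 3 == 0 & nth 0 v 4 == 0]%N.
Proof. by case: v => [|? [|? [|? [|? [|? [|? [|]]]]]]] //= _; lia. Qed.

Lemma has_sE (v : seq nat) : size v = 6 ->
  has_s v = ~~ [&& nth 0 v 0 == 0, nth 0 v 1 == 0 & nth 0 v 2 == 0]%N.
Proof. by case: v => [|? [|? [|? [|? [|? [|? [|]]]]]]] //= _; lia. Qed.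

Lemma forall_lt6 (P : nat -> Prop) : P 0%N -> P 1%N -> P 2%N -> P 3%N -> P 4%N -> P 5%N ->
  forall i, (i < 6)%N -> P i.
Proof. by move=> ? ? ? ? ? ? [|[|[|[|[|[|]]]]]]. Qed.

Lemma contact_angle_lt (o x y x' y' : R) : 0 < o -> 0 < x' -> 0 < y' ->
  x' <= x -> y' <= y -> (x' < x) || (y' < y) ->
  contact_angle o x' y' < contact_angle o x y.
Proof.
move=> o0 x0 y0 xx yy H; apply: contact_angle_mono_lt => //.
- exact: lt_le_trans xx.
- exact: lt_le_trans yy.
- by rewrite ler_pM2r.
- by rewrite ler_pM2r.
- by rewrite !ltr_pM2r.
Qed.

Lemma edge_angle_small (s r : R) : 0 < s -> s < r -> r < 1 ->
  let F := edge_angle s s r 1 in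
  [/\ F 0%N = pi / 3, pi / 3 < F 1%N < pi / 2, pi / 3 < F 2%N < pi / 2,
      pi / 3 < F 3%N < pi & pi / 3 < F 4%N < pi /\ pi / 3 < F 5%N < pi].
Proof.
move=> s0 sr r1; have r0 := lt_trans s0 sr; have s1 := lt_trans sr r1.
rewrite /edge_angle /= contact_angle_id // !contact_angle_lt_pihalf // !contact_angle_ltpi //.
rewrite -(contact_angle_id s0) !andbT.
by do !split => //; apply: contact_angle_lt; rewrite ?sr ?s1 ?orbT // ltW.
Qed.

Lemma angle_sum_small_codes (s r : R) (v : seq nat) : 0 < s -> s < r -> r < 1 ->
  closed_code v -> has_r v || has_1 v -> angle_sum s s r 1 v = 2 * pi -> v \in small_codes.
Proof.
move=> s0 sr r1 cv nv E; have pi0 := pi_gt0 R; have sv := size_closed_code cv.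
have [F0 F1 F2 F3 [F4 F5]] := edge_angle_small s0 sr r1.
(* Some pair other than ss occurs; its angle lies strictly between the two bounds, so both estimates
   below are strict. *)
have [nz|] := boolP [exists i : 'I_6, (0 < i)%N && (nth 0%N v i != 0%N)]; last first.
  move=> /existsPn H; move: nv; rewrite has_rE // has_1E //.
  have {}H (i : nat) : (0 < i < 6)%N -> nth 0%N v i = 0%N.
    by case/andP=> i0 i6; move: (H (Ordinal i6)) => /=; rewrite i0 /= negbK => /eqP.
  by rewrite !H.
have {nz} [i [i0 i6] vi] : exists2 i, (0 < i)%N /\ (i < 6)%N & nth 0%N v i <> 0%N.
  by move/existsP: nz => [i /andP[i0 /eqP vi]]; exists (val i) => //; split=> //; apply: ltn_ord.
rewrite mem_filter; apply/andP; split.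
  rewrite /small_code cv nv !andTb ltnNge; apply/negP => H; apply: vi.
  apply: (@code_sum_tight _ (edge_angle s s r 1) (fun i => (nth 0%N [:: 2; 3; 3; 6; 6; 6] i)%:R * (pi / 6))).
  - by apply: forall_lt6; move: F0 F1 F2 F3 F4 F5; clear; rewrite /=; lra.
  - rewrite code_sum_weight // -[X in _ <= X]/(angle_sum _ _ _ _ _) E.
    by rewrite -(ler_nat R) in H; move: H pi0; clear; nra.
  - by [].
  - by move: i6 i0; case: i => [|[|[|[|[|[|]]]]]] //= _ _; move: F1 F2 F3 F4 F5; clear; rewrite /=; lra.
apply: mem_knapsack => //.
rewrite leqNgt; apply/negP => H; apply: vi.
apply: (@code_sum_tight _ (fun i => (nth 0%N (nseq 6 1%N) i)%:R * (pi / 3)) (edge_angle s s r 1)).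
- by apply: forall_lt6; move: F0 F1 F2 F3 F4 F5; clear; rewrite /=; lra.
- rewrite code_sum_weight // -[X in X <= _]/(angle_sum _ _ _ _ _) E.
  by rewrite -(ler_nat R) in H; move: H pi0; clear; nra.
- by [].
- by move: i6 i0; case: i => [|[|[|[|[|[|]]]]]] //= _ _; move: F1 F2 F3 F4 F5; clear; rewrite /=; lra.
Qed.

Lemma small_code_classes : all (fun v => if v is [:: ss; sr; so; rr; ro; oo] then
  (ss, sr + so, rr + ro + oo) \in [:: (1, 2, 1); (0, 0, 3); (0, 2, 2);
    (1, 4, 0); (2, 2, 1); (0, 0, 4); (0, 4, 1); (1, 2, 2); (0, 2, 3); (0, 0, 5)]
  else false)%N small_codes.
Proof. by vm_compute. Qed.

Lemma small_codes_angle_bounds (s r : R) (v : seq nat) : 0 < s -> s < r -> r < 1 ->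
  v \in small_codes -> angle_sum s s r 1 v = 2 * pi ->
  (angle_bounds v).1%:R * tick <= contact_angle r s s /\
  (angle_bounds v).2%:R * tick <= contact_angle r r s.
Proof.
move=> s0 sr r1; have r0 := lt_trans s0 sr.
move=> /(allP small_code_classes).
case: v => [|ss [|sr' [|so [|rr [|ro [|oo [|]]]]]]] // Hc E.
apply: (apex_angle_bounds s0 sr Hc).
rewrite -(apex_angle_ssr s0 sr) -(apex_angle_srr s0 sr) -E.
(* Replacing 1 by r does not increase the contact angles at the s-circle, so their sum stays at most
   2 pi. *)
apply: le_trans (_ : code_sum [:: ss; sr'; so; rr; ro; oo] (edge_angle s s r r) <= _).
  by rewrite /code_sum !big_ord_recl big_ord0 /edge_angle /= contact_angle_id // !natrD; lra.
apply: code_sum_le.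
by apply: forall_lt6; rewrite /edge_angle //= ltW // contact_angle_lt ?r1 ?orbT // ltW.
Qed.

Lemma edge_angle_medium (s r : R) : 0 < s -> s < r -> r < 1 ->
  let F := edge_angle r s r 1 in
  [/\ F 3%N = pi / 3, F 0%N < pi / 3, F 1%N < pi / 3, F 1%N < F 2%N < pi / 2 &
      pi / 3 < F 4%N < pi / 2 /\ pi / 3 < F 5%N < pi].
Proof.
move=> s0 sr r1; have r0 := lt_trans s0 sr.
have Uro : contact_angle r r 1 < pi / 2 by apply: contact_angle_lt_pihalf.
have Uso : contact_angle r s 1 < pi / 2 by apply: lt_trans Uro; rewrite contact_angle_lt ?sr // ltW.
rewrite /edge_angle /= Uro Uso contact_angle_ltpi // !andbT.
split; last split; rewrite -?(contact_angle_id r0) //;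
  by apply: contact_angle_lt; rewrite ?sr ?r1 ?orbT // ltW.
Qed.

Lemma angle_sum_medium_codes (s r : R) (v : seq nat) (f g : nat) :
  0 < s -> s < r -> r < 1 -> (0 < f)%N -> (0 < g)%N ->
  f%:R * tick <= contact_angle r s s -> g%:R * tick <= contact_angle r r s ->
  closed_code v -> has_s v || has_1 v ->
  angle_sum r s r 1 v = 2 * pi -> v \in medium_codes f g.
Proof.
move=> s0 sr r1 f0 g0 hf hg cv nv E; have pi0 := pi_gt0 R; have sv := size_closed_code cv.
have [F3 F0 F1 F2 [F4 F5]] := edge_angle_medium s0 sr r1.
rewrite contact_angleC in hg.
have lower : (forall i, (i < 6)%N ->
    (nth 0%N [:: f; g; g; 8; 8; 8]%N i)%:R * tick <= edge_angle r s r 1 i).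
  by apply: forall_lt6; move: hf hg F0 F1 F2 F3 F4 F5; clear; rewrite /edge_angle /=; lra.
rewrite mem_filter; apply/andP; split; last first.
  apply: mem_knapsack => //; first by rewrite /= f0 g0.
  have := code_sum_le v lower; rewrite code_sum_weight // -[X in _ <= X]/(angle_sum _ _ _ _ _) E.
  by move=> H; rewrite -(ler_nat R); move: H pi0; clear; nra.
apply/andP; split.
  rewrite /medium_code cv nv !andTb ltnNge; apply/negP => H.
  have upper : (forall i, (i < 6)%N ->
      edge_angle r s r 1 i <= (nth 0%N [:: 8; 8; 12; 8; 12; 24]%N i)%:R * tick).
    by apply: forall_lt6; move: F0 F1 F2 F3 F4 F5; clear; rewrite /=; lra.
  have H' : code_sum v (fun i => (nth 0%N [:: 8; 8; 12; 8; 12; 24]%N i)%:R * tick) <= code_sum v (edge_angle r s r 1).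
    rewrite code_sum_weight // -[X in _ <= X]/(angle_sum _ _ _ _ _) E.
    by rewrite -(ler_nat R) in H; move: H pi0; clear; nra.
  (* Only the angle of rr equals its upper bound; a weight of at most 48 would exclude every other
     pair. *)
  have [z0 z1 z2 z4 z5] : [/\ nth 0%N v 0 = 0%N, nth 0%N v 1 = 0%N, nth 0%N v 2 = 0%N, nth 0%N v 4 = 0%N & nth 0%N v 5 = 0%N].
    by split; apply: (code_sum_tight upper H') => //; move: F0 F1 F2 F4 F5; clear; rewrite /=; lra.
  by move: nv; rewrite has_sE // has_1E // z0 z1 z2 z4 z5.
apply/implyP => h1v; rewrite ltnNge; apply/negP => H.
have H' : code_sum v (edge_angle r s r 1) <= code_sum v (fun i => (nth 0%N [:: f; g; g; 8; 8; 8]%N i)%:R * tick).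
  rewrite code_sum_weight // -[X in X <= _]/(angle_sum _ _ _ _ _) E.
  by rewrite -(ler_nat R) in H; move: H pi0; clear; nra.
(* Pairs containing 1 strictly exceed their lower bounds, so a weight of 48 or more excludes
   them. *)
have [z2 z4 z5] : [/\ nth 0%N v 2 = 0%N, nth 0%N v 4 = 0%N & nth 0%N v 5 = 0%N].
  by split; apply: (code_sum_tight lower H') => //; move: F2 F4 F5 hg; clear; rewrite /edge_angle /=; lra.
by move: h1v; rewrite has_1E // z2 z4 z5.
Qed.

End CodeBounds.

(** * Codes determine radii *)

Section Uniqueness.
Context {R : realType}.

Section Comparison.
Variables (o a b c o' a' b' c' : R) (v : seq nat).
Hypotheses (o0 : 0 < o) (a0 : 0 < a) (b0 : 0 < b) (c0 : 0 < c).
Hypotheses (o'0 : 0 < o') (a'0 : 0 < a') (b'0 : 0 < b') (c'0 : 0 < c').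
Hypotheses (ha : a' * o <= a * o') (hb : b' * o <= b * o') (hc : c' * o <= c * o').
Hypothesis closed_v : closed_code v.
Hypothesis sum_eq : angle_sum o' a' b' c' v = angle_sum o a b c v.

Let edges_le i : (i < 6)%N -> edge_angle o' a' b' c' i <= edge_angle o a b c i.
Proof. by move: i; apply: forall_lt6; apply: contact_angle_mono. Qed.

Let edges_tight i : (i < 6)%N -> edge_angle o' a' b' c' i < edge_angle o a b c i ->
  nth 0%N v i = 0%N.
Proof. by apply: (code_sum_tight edges_le); rewrite -/(angle_sum _ _ _ _ _) -sum_eq. Qed.

(** Relative to the center no letter grows, so no contact angle grows; as the sums agree, a pair
    whose angle strictly decreases cannot occur. The next two lemmas hold for the same reason. *)
Lemma shrunk_not_s : a' * o < a * o' -> has_s v = false.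
Proof.
move=> lt_a; rewrite has_sE ?size_closed_code //.
by rewrite !edges_tight //; apply: contact_angle_mono_lt; rewrite ?lt_a ?orbT.
Qed.

Lemma shrunk_not_r : b' * o < b * o' -> has_r v = false.
Proof.
move=> lt_b; rewrite has_rE ?size_closed_code //.
by rewrite !edges_tight //; apply: contact_angle_mono_lt; rewrite ?lt_b ?orbT.
Qed.

Lemma shrunk_not_1 : c' * o < c * o' -> has_1 v = false.
Proof.
move=> lt_c; rewrite has_1E ?size_closed_code //.
by rewrite !edges_tight //; apply: contact_angle_mono_lt; rewrite ?lt_c ?orbT.
Qed.

End Comparison.

Definition realizes (ck : seq nat * seq nat) (rs : R * R) : Prop :=
  [/\ [/\ 0 < rs.2, rs.2 < rs.1 & rs.1 < 1],
      closed_code ck.1 /\ closed_code ck.2,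
      has_r ck.1 || has_1 ck.1, has_s ck.2 || has_1 ck.2 &
  [/\ has_1 ck.1 || has_1 ck.2,
      angle_sum rs.2 rs.2 rs.1 1 ck.1 = 2 * pi &
      angle_sum rs.1 rs.2 rs.1 1 ck.2 = 2 * pi]].

(* Around a circle whose radius grows by the largest factor no contact angle
   increases, so all its neighbors grow by the same factor. *)
Lemma realizes_le (ck : seq nat * seq nat) (rs rs' : R * R) :
  realizes ck rs -> realizes ck rs' -> rs'.1 <= rs.1 /\ rs'.2 <= rs.2.
Proof.
case: ck rs rs' => c k [r s] [r' s'] /=.
case=> [[/= s0 sr r1] [cc ck] nc nk [has1 Ec Ek]].
case=> [[/= s'0 sr' r1'] _ _ _ [_ Ec' Ek']].
have r0 := lt_trans s0 sr; have r'0 := lt_trans s'0 sr'.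
have one0 : 0 < 1 :> R := ltr01.
(* Here r grows by the largest factor: s and 1 shrink strictly relative to r, so [k] could only
   contain r. *)
have r_case : r' * s > r * s' -> r' > r -> False.
  move=> rs_lt r_lt.
  have hs : s' * r < s * r' by rewrite mulrC [s * _]mulrC.
  have h1 : 1 * r < 1 * r' by rewrite !mul1r.
  have hr : r' * r <= r * r' by rewrite mulrC.
  have E := etrans Ek' (esym Ek).
  have := shrunk_not_s r0 s0 r0 one0 r'0 s'0 r'0 one0 (ltW hs) hr (ltW h1) ck E hs.
  have := shrunk_not_1 r0 s0 r0 one0 r'0 s'0 r'0 one0 (ltW hs) hr (ltW h1) ck E h1.
  by move: nk => /orP[] ->.
(* Here s grows by the largest factor. This excludes 1 from [c], so r occurs in [c] and grows by the
   same factor; then 1 is excluded from [k] too. *)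
have s_case : r' * s <= r * s' -> s' > s -> False.
  move=> rs_le s_lt.
  have h1 : 1 * s < 1 * s' by rewrite !mul1r.
  have hs : s' * s <= s * s' by rewrite mulrC.
  have E := etrans Ec' (esym Ec).
  have c1 := shrunk_not_1 s0 s0 r0 one0 s'0 s'0 r'0 one0 hs rs_le (ltW h1) cc E h1.
  have rs_eq : r' * s = r * s'.
    apply/eqP; rewrite eq_le rs_le leNgt; apply/negP => rs_lt.
    have := shrunk_not_r s0 s0 r0 one0 s'0 s'0 r'0 one0 hs rs_le (ltW h1) cc E rs_lt.
    by move: nc; rewrite c1 orbF => ->.
  have r_lt : r < r' by rewrite -(ltr_pM2r s0) rs_eq ltr_pM2l.
  have h1r : 1 * r < 1 * r' by rewrite !mul1r.
  have hr : r' * r <= r * r' by rewrite mulrC.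
  have hsr : s' * r <= s * r' by rewrite mulrC -rs_eq mulrC.
  have := shrunk_not_1 r0 s0 r0 one0 r'0 s'0 r'0 one0 hsr hr (ltW h1r) ck (etrans Ek' (esym Ek)) h1r.
  by move: has1; rewrite c1 /= => ->.
split; rewrite leNgt; apply/negP => lt.
  have [rs_le|rs_lt] := leP (r' * s) (r * s'); last exact: r_case.
  apply: s_case => //; rewrite -(ltr_pM2l r0); apply: lt_le_trans rs_le.
  by rewrite ltr_pM2r.
have [rs_le|rs_lt] := leP (r' * s) (r * s'); first exact: s_case.
apply: r_case => //; rewrite -(ltr_pM2r s0); apply: lt_trans rs_lt.
by rewrite ltr_pM2l.
Qed.

Lemma realizes_inj (ck : seq nat * seq nat) (rs rs' : R * R) :
  realizes ck rs -> realizes ck rs' -> rs = rs'.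
Proof.
move=> h h'; have [le1 le2] := realizes_le h h'; have [ge1 ge2] := realizes_le h' h.
by case: rs rs' le1 le2 ge1 ge2 {h h'} => [r s] [r' s'] /= *; congr pair; apply/le_anti/andP.
Qed.

(** * Counting the realized code pairs *)

Lemma realizes_mem_code_pairs (ck : seq nat * seq nat) (rs : R * R) :
  realizes ck rs -> compatible ck.1 ck.2 -> ck \in code_pairs.
Proof.
case: ck rs => c k [r s] [[/= s0 sr r1] [cc ck] nc nk [has1 Ec Ek]] comp.
have cS := angle_sum_small_codes s0 sr r1 cc nc Ec.
have [hf hg] := small_codes_angle_bounds s0 sr r1 cS Ec.
apply/allpairsPdep; exists c, k; split => //.
rewrite mem_filter comp /=.
apply: (angle_sum_medium_codes s0 sr r1 _ _ hf hg ck nk Ek); clear.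
  by rewrite /angle_bounds; case: c => [|? [|? [|? [|? [|? [|? [|]]]]]]] //; do !case: ifP.
by rewrite /angle_bounds; case: c => [|? [|? [|? [|? [|? [|? [|]]]]]]] //; do !case: ifP.
Qed.

Local Open Scope classical_set_scope.
Local Open Scope card_scope.

Lemma card_le_code_pairs (A : set (R * R)) (n : nat) : (size code_pairs <= n)%N ->
  (forall rs, A rs -> exists ck, realizes ck rs /\ compatible ck.1 ck.2) ->
  A #<= `I_n.
Proof.
move=> size_le H; move: (realizes_mem_code_pairs) size_le.
move: code_pairs => L mem_L size_le.
(* The only pair realized by the i-th code pair, or (0, 0) if there is none; the image covers
   [A]. *)
pose f (i : nat) : R * R := xget (0, 0) [set rs | realizes (nth ([::], [::]) L i) rs].
apply: (card_le_trans (subset_card_le (_ : A `<=` f @` `I_n))); last exact: card_image_le.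
move=> rs /H [ck [ck_rs comp]].
have ck_in := mem_L _ _ ck_rs comp.
exists (index ck L).
  by apply: leq_trans size_le; rewrite index_mem.
rewrite /f nth_index //; apply: xget_unique => // rs' ck_rs'.
exact: realizes_inj ck_rs' ck_rs.
Qed.

Lemma size_code_pairs : (size code_pairs <= 13617)%N.
Proof. by vm_compute. Qed.

End Uniqueness.

(** * Coronas *)

Section Geometry.
Context {R : realType}.
Implicit Types (P X : set (circle R)) (S C D : circle R).

Lemma edist_ge0 (x y : R * R) : 0 <= edist x y.
Proof. exact: sqrtr_ge0. Qed.

Lemma sqr_edist (x y : R * R) :
  edist x y ^+ 2 = (x.1 - y.1) ^+ 2 + (x.2 - y.2) ^+ 2.
Proof. by rewrite sqr_sqrtr // addr_ge0 ?sqr_ge0. Qed.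

Lemma edistC (x y : R * R) : edist x y = edist y x.
Proof. by rewrite /edist -(sqrrN (x.1 - y.1)) -(sqrrN (x.2 - y.2)) !opprB. Qed.

Definition polar (o : R * R) (d t : R) : R * R := (o.1 + d * cos t, o.2 + d * sin t).

Lemma sqr_edist_polar (o : R * R) (d e t u : R) :
  edist (polar o d t) (polar o e u) ^+ 2 = d ^+ 2 + e ^+ 2 - 2 * d * e * cos (u - t).
Proof.
have := cos2Dsin2 t; have := cos2Dsin2 u => hu ht.
rewrite sqr_edist /= cosB.
rewrite -[d ^+ 2]mulr1 -[e ^+ 2]mulr1 -{1}ht -{1}hu; ring.
Qed.

Lemma edist_scale (x y : R * R) (l : R) : 0 <= l ->
  edist x (x.1 + l * (y.1 - x.1), x.2 + l * (y.2 - x.2)) = l * edist x y.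
Proof.
move=> l0; rewrite /edist /= (_ : _ + _ = l ^+ 2 * ((x.1 - y.1) ^+ 2 + (x.2 - y.2) ^+ 2)).
  by rewrite sqrtrM ?sqr_ge0 // sqrtr_sqr ger0_norm.
ring.
Qed.

Lemma packing_edist P C D : circle_packing P -> P C -> P D -> C <> D ->
  radius C + radius D <= edist (center C) (center D).
Proof.
move=> packP PC PD CD; rewrite leNgt; apply/negP => lt; apply: CD.
apply: packP => //.
have c0 := radius_gt0 C; have d0 := radius_gt0 D.
(* The point dividing the segment of centers in the ratio of the radii lies in both open discs. *)
set l := radius C / (radius C + radius D).
have l0 : 0 < l by rewrite divr_gt0 ?addr_gt0.
have l1 : 1 - l = radius D / (radius C + radius D) by rewrite /l; field; lra.
have l1_0 : 0 < 1 - l by rewrite l1 divr_gt0 ?addr_gt0.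
exists ((center C).1 + l * ((center D).1 - (center C).1),
        (center C).2 + l * ((center D).2 - (center C).2)); split; rewrite /open_disc /=.
  rewrite edist_scale ?ltW // /l mulrAC ltr_pdivrMr ?addr_gt0 // ltr_pM2l //.
have -> : ((center C).1 + l * ((center D).1 - (center C).1),
        (center C).2 + l * ((center D).2 - (center C).2)) =
  ((center D).1 + (1 - l) * ((center C).1 - (center D).1),
        (center D).2 + (1 - l) * ((center C).2 - (center D).2)).
  by congr pair; ring.
by rewrite edist_scale ?ltW // l1 mulrAC ltr_pdivrMr ?addr_gt0 // ltr_pM2l // edistC.
Qed.

Lemma angle_tangent S C D : tangent S C -> tangent S D -> tangent C D ->
  angle (center S) (center C) (center D) = contact_angle (radius S) (radius C) (radius D).
Proof.
rewrite /tangent => SC SD CD.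
have s0 := radius_gt0 S; have c0 := radius_gt0 C; have d0 := radius_gt0 D.
have := sqr_edist (center S) (center C); rewrite SC => SC2.
have := sqr_edist (center S) (center D); rewrite SD => SD2.
have := sqr_edist (center C) (center D); rewrite CD => CD2.
rewrite /angle /contact_angle; congr acos.
rewrite SC SD.
have -> : ((center C).1 - (center S).1) * ((center D).1 - (center S).1) +
    ((center C).2 - (center S).2) * ((center D).2 - (center S).2) =
    ((radius S + radius C) ^+ 2 + (radius S + radius D) ^+ 2 - (radius C + radius D) ^+ 2) / 2.
  by rewrite SC2 SD2 CD2; field.
by field; lra.
Qed.

(** The unit vector from [o] to [z] is rotated by [- t0] before taking its polar angle. *)
Lemma polar_at (o z : R * R) (t0 : R) : o <> z ->
  exists t, [/\ 0 <= t, t < 2 * pi & z = polar o (edist o z) (t0 + t)].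
Proof.
move=> oz; set d := edist o z.
have d0 : 0 < d.
  rewrite lt_neqAle edist_ge0 andbT; apply/eqP => d0; apply: oz.
  have := sqr_edist o z; rewrite -/d -d0 expr0n /= => /esym/eqP.
  rewrite paddr_eq0 ?sqr_ge0 // !sqrf_eq0 !subr_eq0 => /andP[/eqP h1 /eqP h2].
  by case: o z h1 h2 {d d0} => ? ? [? ?] /= -> ->.
have d2 := sqr_edist o z; rewrite -/d in d2.
have ht := cos2Dsin2 t0.
pose x := (z.1 - o.1) / d; pose y := (z.2 - o.2) / d.
have xy : x ^+ 2 + y ^+ 2 = 1.
  have -> : x ^+ 2 + y ^+ 2 = ((o.1 - z.1) ^+ 2 + (o.2 - z.2) ^+ 2) / d ^+ 2.
    by rewrite /x /y; field; rewrite gt_eqF.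
  by rewrite -d2 divff // expf_neq0 // gt_eqF.
have rot : (x * cos t0 + y * sin t0) ^+ 2 + (y * cos t0 - x * sin t0) ^+ 2 = 1.
  by rewrite -[RHS]mulr1 -{1}xy -ht; ring.
have [t [t_ge t_lt hx hy]] := polar_coordinates rot.
exists t; split => //.
have hc : cos (t0 + t) = x.
  by rewrite cosD -hx -hy -[RHS]mulr1 -ht; ring.
have hs : sin (t0 + t) = y.
  by rewrite sinD -hx -hy -[RHS]mulr1 -ht; ring.
by rewrite /polar hc hs /x /y; case: (z) => z1 z2 /=; congr pair; field; rewrite gt_eqF.
Qed.

Lemma edist_gt0_neq (x y : R * R) : 0 < edist x y -> x <> y.
Proof. by move=> + xy; rewrite -xy /edist !subrr expr0n addr0 sqrtr0 ltxx. Qed.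

(* The angles between consecutive neighbors are at most the increments of their
   polar angles, and both add up to 2 pi; hence they agree. *)
Lemma corona_sector P S (m : nat) (A : 'I_m -> circle R) (z : R * R) :
  neighbors P S A -> center S <> z ->
  exists (i : 'I_m) (t psi : R), let s := radius S in
    let a := radius (A i) in let b := radius (A (ordS i)) in
    let delta := contact_angle s a b in
    [/\ 0 <= psi, psi < delta,
        center (A i) = polar (center S) (s + a) t,
        center (A (ordS i)) = polar (center S) (s + b) (t + delta) &
        z = polar (center S) (edist (center S) z) (t + psi)].
Proof.
move=> [[[_ _ tanS tanA] _] [t [Ht Hord]] surr] Sz.
have {Sz} dir t0 := polar_at t0 Sz.
have pi0 := pi_gt0 R.
case: m A tanS tanA t Ht Hord surr => [|n] A tanS tanA t Ht Hord surr.
  by move: surr; rewrite /surrounds big_ord0; lra.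
have s0 := radius_gt0 S.
have a0 i := radius_gt0 (A i).
pose delta i := contact_angle (radius S) (radius (A i)) (radius (A (ordS i))).
have sum_delta : \sum_i delta i = 2 * pi.
  rewrite -surr; apply: eq_bigr => i _.
  by rewrite angle_tangent.
(* From the last neighbor back to the first, a full turn has to be added. *)
pose turn (i : 'I_n.+1) : R := if i == ord_max then 2 * pi else 0.
pose gap i := t (ordS i) - t i + turn i.
have cos_turn i x : cos (x + turn i) = cos x.
  by rewrite /turn; case: ifP; rewrite ?addr0 // mulr_natl cosD2pi.
have sin_turn i x : sin (x + turn i) = sin x.
  by rewrite /turn; case: ifP; rewrite ?addr0 // mulr_natl sinD2pi.
have sum_gap : \sum_i gap i = 2 * pi.
  have shift : \sum_i t (ordS i) = \sum_i t i.
    by rewrite [RHS](reindex_inj (@ordS_inj n.+1)).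
  rewrite !big_split /= sumrN shift subrr add0r.
  rewrite (bigD1 ord_max) //= /turn eqxx big1 ?addr0 // => i /negPf -> //.
have pA i : center (A i) = polar (center S) (radius S + radius (A i)) (t i).
  by rewrite Ht -tanS.
have cos_gap i : cos (gap i) = cos (delta i).
  rewrite cos_turn cos_contact_angle //.
  have := sqr_edist_polar (center S) (radius S + radius (A i)) (radius S + radius (A (ordS i))) (t i) (t (ordS i)).
  rewrite -!pA tanA; move: (cos _) => c H.
  have := a0 i; have := a0 (ordS i); move: (radius (A i)) (radius (A (ordS i))) H => a b H b0' a0'.
  have {}H : 2 * (radius S + a) * (radius S + b) * c = 2 * (radius S + a) * (radius S + b) - 4 * a * b by lra.
  have h : 2 * (radius S + a) * (radius S + b) != 0 by rewrite !mulf_neq0 // gt_eqF // addr_gt0.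
  by apply: (mulfI h); rewrite H; field; lra.
have ordS_lt (i : 'I_n.+1) : i != ord_max -> (i < ordS i)%N.
  move=> im; rewrite /= modn_small // ltn_neqAle ltn_ord andbT.
  by rewrite eqSS.
have ordS_max : ordS (ord_max : 'I_n.+1) = ord0 by apply: val_inj; rewrite /= modnn.
have gap_gt0 i : 0 < gap i.
  rewrite /gap /turn; case: eqP => [->|/eqP im].
    rewrite ordS_max; have [->|n0] := eqVneq (ord_max : 'I_n.+1) ord0; first by lra.
    have /andP[_ h] : t ord0 < t ord_max < t ord0 + 2 * pi.
      by apply: Hord; rewrite lt0n; apply: contraNneq n0 => n0; apply/eqP/val_inj.
    by lra.
  by have /andP[h _] := Hord _ _ (ordS_lt _ im); lra.
have delta_le i : delta i <= gap i.
  by rewrite contact_angle_le ?(ltW (gap_gt0 i)) // -cos_contact_angle // cos_gap.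
have delta_gap i : delta i = gap i.
  have : \sum_j (gap j - delta j) = 0 by rewrite sumrB sum_gap sum_delta subrr.
  move/eqP; rewrite psumr_eq0; last by move=> j _; rewrite subr_ge0.
  by move=> /allP /(_ i); rewrite mem_index_enum => /(_ isT) /= /eqP; lra.
have [phi [phi0 phi2 hz]] := dir (t ord0).
set tau := t ord0 + phi in hz.
have t0_le : t ord0 <= tau by rewrite /tau; lra.
(* The sector of [z] starts at the last neighbor whose polar angle is at most [tau]; the final
   sector extends up to [t ord0 + 2 * pi]. *)
have [i ti imax] := @arg_maxnP _ ord0 (fun i => t i <= tau) (fun i => val i) t0_le.
exists i, (t i), (tau - t i); rewrite /=; split.
- by rewrite subr_ge0.
- rewrite -/(delta i) delta_gap /gap /turn; case: eqP => [->|/eqP im].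
    by rewrite ordS_max /tau; lra.
  have := ordS_lt i im; rewrite addr0 ltrD2r ltNge => lt; apply/negP => /imax ge.
  by move: lt; rewrite ltnNge => /negP; apply; exact: ge.
- exact: pA.
- rewrite -/(delta i) delta_gap pA /polar /gap.
  have -> : t i + (t (ordS i) - t i + turn i) = t (ordS i) + turn i by ring.
  by rewrite cos_turn sin_turn.
by rewrite addrC subrK.
Qed.

Lemma sector_edist (o x y : R * R) (d e t u : R) : x = polar o d t -> y = polar o e u ->
  edist x y ^+ 2 = d ^+ 2 + e ^+ 2 - 2 * d * e * cos (u - t).
Proof. by move=> -> ->; rewrite sqr_edist_polar. Qed.

(** The right-hand side is the squared distance between the centers of circles of radii [a] and [c]
    that touch the circle of radius [s] at angle [t] from each other; contact is the extreme case of
    not overlapping. *)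
Lemma contact_angle_le_disjoint (s a c t : R) : 0 < s -> 0 < a -> 0 < c -> 0 <= t ->
  (a + c) ^+ 2 <= (s + a) ^+ 2 + (s + c) ^+ 2 - 2 * (s + a) * (s + c) * cos t ->
  contact_angle s a c <= t.
Proof.
move=> s0 a0 c0 t0 H; apply: contact_angle_le => //.
have h : 0 < 2 * (s + a) * (s + c) by rewrite !mulr_gt0 ?addr_gt0.
rewrite -(ler_pM2l h).
have -> : 2 * (s + a) * (s + c) * (1 - 2 * (a / (s + a)) * (c / (s + c))) =
  2 * (s + a) * (s + c) - 4 * a * c by field; lra.
lra.
Qed.

Lemma tangent_center_neq S C : tangent S C -> center S <> center C.
Proof.
move=> SC; apply: edist_gt0_neq; rewrite SC.
by rewrite addr_gt0 ?radius_gt0.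
Qed.

(** The center of [C] lies in the sector of two consecutive neighbors. Were [C] neither of them,
    disjointness would make this sector at least the sum of their contact angles with [C], hence
    with a circle as large as [S], against [contact_angle_interstice]. *)
Lemma tangent_mem_neighbors P S C (m : nat) (A : 'I_m -> circle R) :
  circle_packing P -> neighbors P S A -> P C -> tangent S C ->
  radius S <= radius C -> exists i, A i = C.
Proof.
move=> packP nbA PC SC le_SC.
have [i [t [psi [psi0 psi_lt pA pB pC]]]] := corona_sector nbA (tangent_center_neq SC).
have PA : forall i, P (A i) by have [[[]]] := nbA.
have s0 := radius_gt0 S; have c0 := radius_gt0 C.
have a0 := radius_gt0 (A i); have b0 := radius_gt0 (A (ordS i)).
rewrite SC in pC.
have [|nA] := pselect (A i = C); first by exists i.
have [|nB] := pselect (A (ordS i) = C); first by exists (ordS i).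
exfalso.
have hA := packing_edist packP (PA i) PC nA.
have hB := packing_edist packP (PA (ordS i)) PC nB.
have eA := sector_edist pA pC; have eB := sector_edist pC pB.
move: (edist_ge0 (center (A i)) (center C)) (edist_ge0 (center C) (center (A (ordS i)))).
rewrite edistC in hB.
move: (edist (center (A i)) _) hA eA => x hA eA.
move: (edist (center C) _) hB eB => y hB eB x0 y0.
have E1 : t + psi - t = psi by ring.
have E2 d : t + d - (t + psi) = d - psi by ring.
rewrite E1 in eA; rewrite E2 in eB.
have le1 : contact_angle (radius S) (radius (A i)) (radius C) <= psi.
  apply: contact_angle_le_disjoint => //; rewrite -eA.
  by rewrite ler_sqr ?nnegrE // addr_ge0 ?ltW.
have le2 : contact_angle (radius S) (radius C) (radius (A (ordS i))) <=
    contact_angle (radius S) (radius (A i)) (radius (A (ordS i))) - psi.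
  apply: contact_angle_le_disjoint => //; first by rewrite subr_ge0 ltW.
  by rewrite -eB ler_sqr ?nnegrE 1?addrC // addr_ge0 ?ltW.
have := contact_angle_interstice s0 a0 b0.
have m1 : contact_angle (radius S) (radius (A i)) (radius S) <=
    contact_angle (radius S) (radius (A i)) (radius C).
  by apply: contact_angle_mono; rewrite // ler_pM2r.
have m2 : contact_angle (radius S) (radius S) (radius (A (ordS i))) <=
    contact_angle (radius S) (radius C) (radius (A (ordS i))).
  by apply: contact_angle_mono; rewrite // ler_pM2r.
by move: le1 le2 m1 m2; clear; lra.
Qed.

(** * Descent of the power of a point *)

Definition power (z : R * R) C : R := edist (center C) z ^+ 2 - radius C ^+ 2.

(** The worst case is a = b = c and D = q + c. It gives (D cos x)^2 >= q^2 + 2qc >= 3q^2, and 3 / 2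
    is a rational number below the square root of 3. *)
Lemma half_contact_angle (q c a b D x : R) : 0 < q -> q <= c -> 0 < a -> a <= c ->
  0 < b -> b <= c -> q + c <= D -> 0 <= x -> 2 * x <= contact_angle q a b ->
  3 / 2 * q <= D * cos x.
Proof.
move=> q0 qc a0 ac b0 bc hD x0 hx; have c0 := lt_le_trans a0 ac.
have cosd := cos_contact_angle q0 a0 b0.
have dpi := contact_angle_ltpi q0 a0 b0; have pi0 := pi_gt0 R.
have h2 : 1 - 2 * (a / (q + a)) * (b / (q + b)) <= 2 * cos x ^+ 2 - 1.
  by rewrite -cos_double -cosd cos_le_cos //; move: x0 hx dpi; clear; lra.
have cx : 0 <= cos x by apply: cos_ge0_pihalf; move: x0 hx dpi pi0; clear; lra.
have D0 : 0 <= D by move: hD q0 c0; clear; lra.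
have /andP[p0 _] := ratio_itv q0 a0; have /andP[p'0 _] := ratio_itv q0 b0.
have pa : a / (q + a) <= c / (q + c) by rewrite ratio_le // ler_pM2r.
have pb : b / (q + b) <= c / (q + c) by rewrite ratio_le // ler_pM2r.
have pp := ler_pM (ltW p0) (ltW p'0) pa pb.
have h3 : 1 - (c / (q + c)) ^+ 2 <= cos x ^+ 2.
  by move: h2 pp; rewrite expr2; clear; lra.
have q32 : 0 <= 3 / 2 * q by move: q0; clear; lra.
have Dc := mulr_ge0 D0 cx.
rewrite -ler_sqr ?nnegrE //.
have h4 : (q + c) ^+ 2 * cos x ^+ 2 <= (D * cos x) ^+ 2.
  rewrite exprMn ler_wpM2r ?sqr_ge0 // ler_sqr ?nnegrE // addr_ge0 // ltW //.
apply: le_trans h4; apply: le_trans (ler_wpM2l (sqr_ge0 _) h3).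
have -> : (q + c) ^+ 2 * (1 - (c / (q + c)) ^+ 2) = q ^+ 2 + 2 * q * c by field; lra.
by move: q0 qc; clear; nra.
Qed.

(* With D the distance from S to C, moving from S, of radius q, to a neighbor of
   radius a at angle psi from C lowers the power by 2 (q + a) (D cos psi - q).
   The neighbor closer in angle to C satisfies half_contact_angle. *)
Lemma neighbor_power_drop P S C (m : nat) (A : 'I_m -> circle R) (r : R) :
  circle_packing P -> P S -> P C -> neighbors P S A -> S <> C ->
  radius S <= radius C -> (forall i, radius (A i) <= radius C) ->
  0 < r -> r <= radius S ->
  exists i, power (center C) (A i) <= power (center C) S - r ^+ 2.
Proof.
move=> packP PS PC nbA nSC le_SC le_AC r0 rS.
have s0 := radius_gt0 S; have c0 := radius_gt0 C.
have hD := packing_edist packP PS PC nSC.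
have SC : center S <> center C by apply: edist_gt0_neq; apply: lt_le_trans hD; rewrite addr_gt0.
have [i [t [psi [psi0 psi_lt pA pB pC]]]] := corona_sector nbA SC.
have a0 := radius_gt0 (A i); have b0 := radius_gt0 (A (ordS i)).
have leA := le_AC i; have leB := le_AC (ordS i).
have eA := sector_edist pA pC; have eB := sector_edist pB pC.
have E1 : t + psi - t = psi by ring.
have E2 d : t + psi - (t + d) = - (d - psi) by ring.
rewrite E1 in eA; rewrite E2 cosN in eB.
rewrite /power.
move: (edist (center S) (center C)) hD eA eB => D hD eA eB.
have half x := half_contact_angle (x := x) s0 le_SC a0 leA b0 leB hD.
(* With q the radius of [S] and X = D cx >= 3q / 2, the drop 2 (q + a) (X - q) is at least (q + a) q
   >= r^2. *)
have drop (a cx : R) : 0 < a -> 3 / 2 * radius S <= D * cx ->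
    (radius S + a) ^+ 2 + D ^+ 2 - 2 * (radius S + a) * D * cx - a ^+ 2 <=
    D ^+ 2 - radius S ^+ 2 - r ^+ 2.
  move: rS r0 s0; move: (radius S) => q rS r0 s0 a1; move: (D * cx) (mulrA (2 * (q + a)) D cx) => X <- hX.
  have : (q + a) * (3 / 2 * q) <= (q + a) * X by rewrite ler_wpM2l // ltW // addr_gt0.
  by move: rS r0 s0 a1; clear; nra.
have [le1|lt1] := leP (2 * psi) (contact_angle (radius S) (radius (A i)) (radius (A (ordS i)))).
  by exists i; rewrite eA; apply: drop => //; apply: half.
exists (ordS i); rewrite eB; apply: drop => //; apply: half.
  by rewrite subr_ge0 ltW.
by move: lt1; clear; lra.
Qed.

(** Were [X] closed under neighbors, [neighbor_power_drop] could be iterated inside [X], and the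
    power of the center of [C] would decrease without bound; but this center lies outside every
    circle of [X], so its power is nonnegative. *)
Lemma exists_neighbor_outside P X S0 C (r : R) :
  compact_packing P -> X `<=` P -> X S0 -> P C -> ~ X C -> 0 < r ->
  (forall S, X S -> r <= radius S <= radius C) ->
  exists S, X S /\ exists (m : nat) (A : 'I_m -> circle R),
    neighbors P S A /\ exists i, ~ X (A i).
Proof.
move=> [packP nbP] XP XS0 PC nXC r0 Xr; apply: contrapT => noexit.
have closed S m (A : 'I_m -> circle R) : X S -> neighbors P S A -> forall i, X (A i).
  move=> XS nbA i; apply: contrapT => nXA; apply: noexit.
  by exists S; split => //; exists m, A; split => //; exists i.
have descent n : exists2 S, X S & power (center C) S <= power (center C) S0 - n%:R * r ^+ 2.
  elim: n => [|n [S XS le_n]]; first by exists S0; rewrite ?mul0r ?subr0.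
  have [m [A nbA]] := nbP S (XP _ XS).
  have XA := closed _ _ _ XS nbA.
  have /andP[rS SC] := Xr _ XS.
  have nSC : S <> C by move=> E; apply: nXC; rewrite -E.
  have AC i : radius (A i) <= radius C by have /andP[] := Xr _ (XA i).
  have [i drop] := neighbor_power_drop packP (XP _ XS) PC nbA nSC SC AC r0 rS.
  exists (A i) => //; apply: (le_trans drop).
  by rewrite -natr1 mulrDl mul1r opprD addrA lerD2r.
have [n] : exists n : nat, power (center C) S0 < n%:R * r ^+ 2.
  have r2 : 0 < r ^+ 2 by rewrite exprn_gt0.
  exists (Num.bound `|power (center C) S0 / r ^+ 2|).
  rewrite -ltr_pdivrMr //; apply: le_lt_trans (ler_norm _) _.
  exact: (archi_boundP (normr_ge0 _)).
have [S XS le_n] := descent n => lt_n.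
have pos : 0 <= power (center C) S.
  have nSC : S <> C by move=> E; apply: nXC; rewrite -E.
  have := packing_edist packP (XP _ XS) PC nSC.
  have s0 := radius_gt0 S; have c0 := radius_gt0 C.
  rewrite subr_ge0 => h; rewrite ler_sqr ?nnegrE ?edist_ge0 // ?ltW //.
  by apply: lt_le_trans h; rewrite ltrDl.
by move: lt_n le_n pos; clear; lra.
Qed.

End Geometry.

(** * Cyclic words and their codes *)

Section Words.
Local Open Scope nat_scope.

Inductive letter := Ls | Lr | L1.

Definition is_s (a : letter) : bool := if a is Ls then true else false.
Definition is_r (a : letter) : bool := if a is Lr then true else false.
Definition is_1 (a : letter) : bool := if a is L1 then true else false.

Definition edge_kind (a b : letter) : nat :=
  match a, b with
  | Ls, Ls => 0 | Ls, Lr | Lr, Ls => 1 | Ls, L1 | L1, Ls => 2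
  | Lr, Lr => 3 | Lr, L1 | L1, Lr => 4 | L1, L1 => 5
  end.

Lemma edge_kind_lt6 (a b : letter) : edge_kind a b < 6.
Proof. by case: a; case: b. Qed.

Section Word.
Variables (m : nat) (l : 'I_m -> letter).

Let kind (i : 'I_m) : nat := edge_kind (l i) (l (ordS i)).

Definition word_code : seq nat := mkseq (fun k => \sum_i (kind i == k)) 6.

Lemma nth_word_code (k : nat) : k < 6 -> nth 0 word_code k = \sum_i (kind i == k).
Proof. exact: nth_mkseq. Qed.

Lemma word_code_eq0 (k : nat) (i : 'I_m) : k < 6 -> nth 0 word_code k = 0 -> kind i != k.
Proof.
move=> k6; rewrite nth_word_code // => /eqP; rewrite sum_nat_eq0 => /forallP /(_ i).
by rewrite eqb0.
Qed.

Lemma word_code_gt0 (k : nat) : k < 6 -> nth 0 word_code k != 0 -> exists i, kind i = k.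
Proof.
move=> k6; rewrite nth_word_code // sum_nat_eq0 negb_forall => /existsP [i].
by rewrite eqb0 negbK => /eqP E; exists i.
Qed.

Lemma cyclic_const (p : 'I_m -> bool) : (forall i, p (ordS i) = p i) ->
  forall i j, p i = p j.
Proof.
move=> pS; case: m p pS => [|n] p pS; first by case=> k lt_k; exfalso; rewrite ltn0 in lt_k.
have p0 k (lt_k : k < n.+1) : p (Ordinal lt_k) = p ord0.
  elim: k lt_k => [|k IH] lt_k; first by congr p; apply: val_inj.
  rewrite -(IH (ltnW lt_k)) -[RHS]pS; congr p; apply: val_inj => /=.
  by rewrite modn_small.
by move=> [i lt_i] [j lt_j]; rewrite !p0.
Qed.

Lemma sum_endpoints (p : letter -> bool) :
  \sum_i (p (l i) + p (l (ordS i))) = 2 * \sum_i p (l i).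
Proof.
rewrite big_split /= mulSn mul1n; congr (_ + _).
by rewrite [RHS](reindex_inj (@ordS_inj m)).
Qed.

(** For each letter, twice its pairs of equal letters plus its mixed pairs is twice its number of
    occurrences, whence the parities. If no mixed pair of a letter occurs, then being that letter is
    constant along the cycle, whence connectedness. *)
Lemma closed_word_code : closed_code word_code.
Proof.
have even x y z (p : letter -> bool) : 2 * x + (y + z) = 2 * \sum_i p (l i) -> ~~ odd (y + z).
  by move/(congr1 odd); rewrite oddD !mul2n !odd_double => /= ->.
have conn (p : letter -> bool) : (forall i, p (l (ordS i)) = p (l i)) ->
  (forall i, ~~ p (l i)) \/ (forall i, p (l i)).
  move=> /cyclic_const pc; have [/existsP [i pi]|] := boolP [exists i, p (l i)].
    by right => j; rewrite (pc j i).
  by rewrite negb_exists => /forallP ?; left.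
rewrite /closed_code /word_code /=.
have E0 k : k < 6 -> \sum_i (kind i == k) = 0 -> forall i, kind i != k.
  by move=> k6 E i; apply: word_code_eq0 => //; rewrite nth_word_code.
have Z k : (forall i, kind i != k) -> \sum_i (kind i == k) = 0.
  by move=> H; apply: big1 => i _; rewrite (negPf (H i)).
apply/and5P; split; last (apply/andP; split).
- apply: (even (\sum_i (kind i == 0)) _ _ is_s); rewrite -sum_endpoints.
  rewrite big_distrr -!big_split /=; apply: eq_bigr => i _.
  by rewrite /kind; case: (l i); case: (l (ordS i)).
- rewrite addnC; apply: (even (\sum_i (kind i == 3)) _ _ is_r); rewrite -sum_endpoints.
  rewrite big_distrr -!big_split /=; apply: eq_bigr => i _.
  by rewrite /kind; case: (l i); case: (l (ordS i)).
- apply: (even (\sum_i (kind i == 5)) _ _ is_1); rewrite -sum_endpoints.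
  rewrite big_distrr -!big_split /=; apply: eq_bigr => i _.
  by rewrite /kind; case: (l i); case: (l (ordS i)).
- apply/implyP; rewrite addn_eq0 => /andP[/eqP/E0 k1 /eqP/E0 k2].
  have same i : is_s (l (ordS i)) = is_s (l i).
    by move: (k1 isT i) (k2 isT i); rewrite /kind; case: (l i); case: (l (ordS i)).
  apply/orP; case: (conn _ same) => H; [left | right]; rewrite !Z // => i;
    by move: (H i); rewrite /kind; case: (l i); case: (l (ordS i)).
- apply/implyP; rewrite addn_eq0 => /andP[/eqP/E0 k1 /eqP/E0 k2].
  have same i : is_r (l (ordS i)) = is_r (l i).
    by move: (k1 isT i) (k2 isT i); rewrite /kind; case: (l i); case: (l (ordS i)).
  apply/orP; case: (conn _ same) => H; [left | right]; rewrite !Z // => i;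
    by move: (H i); rewrite /kind; case: (l i); case: (l (ordS i)).
- apply/implyP; rewrite addn_eq0 => /andP[/eqP/E0 k1 /eqP/E0 k2].
  have same i : is_1 (l (ordS i)) = is_1 (l i).
    by move: (k1 isT i) (k2 isT i); rewrite /kind; case: (l i); case: (l (ordS i)).
  apply/orP; case: (conn _ same) => H; [left | right]; rewrite !Z // => i;
    by move: (H i); rewrite /kind; case: (l i); case: (l (ordS i)).
Qed.

Lemma word_code_letter (p : letter -> bool) (k1 k2 k3 : nat) :
  (forall a b, p a || p b = (edge_kind a b \in [:: k1; k2; k3])) -> maxn k1 (maxn k2 k3) < 6 ->
  ~~ [&& nth 0 word_code k1 == 0, nth 0 word_code k2 == 0 & nth 0 word_code k3 == 0] =
  [exists i, p (l i)].
Proof.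
move=> pE; rewrite !gtn_max => /and3P[lt1 lt2 lt3].
apply/idP/existsP => [|[i pi]]; last first.
  apply/negP => /and3P[/eqP z1 /eqP z2 /eqP z3].
  move: (word_code_eq0 i lt1 z1) (word_code_eq0 i lt2 z2) (word_code_eq0 i lt3 z3).
  have := pE (l i) (l (ordS i)); rewrite pi /= !inE -/(kind i) => /esym.
  by move=> /or3P[] /eqP ->; rewrite eqxx.
have pick i : kind i \in [:: k1; k2; k3] -> exists i, p (l i).
  by rewrite -pE => /orP[]; [exists i | exists (ordS i)].
rewrite !negb_and => /or3P[] /word_code_gt0 [] // i ki; apply: (pick i);
  by rewrite ki !inE eqxx ?orbT.
Qed.

Lemma has_s_word_code : has_s word_code = [exists i, is_s (l i)].
Proof. by rewrite has_sE //; apply: word_code_letter => // -[] []. Qed.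

Lemma has_r_word_code : has_r word_code = [exists i, is_r (l i)].
Proof. by rewrite has_rE //; apply: word_code_letter => // -[] []. Qed.

Lemma has_1_word_code : has_1 word_code = [exists i, is_1 (l i)].
Proof. by rewrite has_1E //; apply: word_code_letter => // -[] []. Qed.

Lemma code_sum_word_code (R : realType) (F : nat -> R) :
  code_sum word_code F = (\sum_i F (kind i))%R.
Proof.
pose kind' i : 'I_6 := Ordinal (edge_kind_lt6 (l i) (l (ordS i))).
rewrite (partition_big kind' predT) //=; apply: eq_bigr => k _.
rewrite nth_word_code // natr_sum mulr_suml [RHS]big_mkcond; apply: eq_bigr => i _ /=.
rewrite -(inj_eq val_inj) /= -/(kind i).
by case: eqP => [->|_]; rewrite ?mul1r ?mul0r.
Qed.

End Word.
End Words.

(** * Codes of a packing *)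

Section Packing.
Context {R : realType}.
Variables (r s : R) (P : set (circle R)).
Hypotheses (s0 : 0 < s) (sr : s < r) (r1 : r < 1).
Hypotheses (compP : compact_packing P) (radiiP : radii P = [set s; r; 1]).

Definition letter_of (C : circle R) : letter :=
  if radius C == s then Ls else if radius C == r then Lr else L1.

Definition letter_radius (a : letter) : R :=
  match a with Ls => s | Lr => r | L1 => 1 end.

Lemma radius_cases C : P C -> [\/ radius C = s, radius C = r | radius C = 1].
Proof.
move=> PC; have : radii P (radius C) by exists C.
by rewrite radiiP => -[[->|->]|->]; [constructor 1 | constructor 2 | constructor 3].
Qed.

Lemma letter_ofK C : P C -> letter_radius (letter_of C) = radius C.
Proof.
rewrite /letter_of => /radius_cases; case: eqP => [->//|ns]; case: eqP => [->//|nr].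
by case.
Qed.

Lemma letter_of_s C : P C -> is_s (letter_of C) = (radius C == s).
Proof. by rewrite /letter_of; case: eqP => // _; case: eqP. Qed.

Lemma letter_of_r C : P C -> is_r (letter_of C) = (radius C == r).
Proof. by rewrite /letter_of; case: eqP => [->|_]; [rewrite lt_eqF | case: eqP]. Qed.

Lemma letter_of_1 C : P C -> is_1 (letter_of C) = (radius C == 1).
Proof.
move=> PC; rewrite /letter_of; case: eqP => [->|ns].
  by rewrite lt_eqF // (lt_trans sr).
case: eqP => [->|nr]; first by rewrite lt_eqF.
by case: (radius_cases PC) => // ->; rewrite eqxx.
Qed.

Section Corona.
Variables (S : circle R) (m : nat) (A : 'I_m -> circle R).
Hypothesis nbA : neighbors P S A.

Definition corona_code : seq nat := word_code (letter_of \o A).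

Lemma neighbors_in i : P (A i).
Proof. by have [[[]]] := nbA. Qed.

Lemma corona_code_sum : angle_sum (radius S) s r 1 corona_code = 2 * pi.
Proof.
have [[[_ PA tanS tanA] _] _ surr] := nbA.
rewrite /angle_sum code_sum_word_code -surr; apply: eq_bigr => i _ /=.
rewrite angle_tangent // -(letter_ofK (PA i)) -(letter_ofK (PA (ordS i))).
case: (letter_of (A i)); case: (letter_of (A (ordS i))); rewrite /edge_angle //=;
  exact: contact_angleC.
Qed.

Lemma corona_has_s : has_s corona_code <-> exists i, radius (A i) = s.
Proof.
rewrite /corona_code has_s_word_code; split => [/existsP|] [i].
  by rewrite letter_of_s => [/eqP|]; [exists i | exact: neighbors_in].
by move=> Ai; apply/existsP; exists i; rewrite /= letter_of_s ?Ai //; exact: neighbors_in.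
Qed.

Lemma corona_has_r : has_r corona_code <-> exists i, radius (A i) = r.
Proof.
rewrite /corona_code has_r_word_code; split => [/existsP|] [i].
  by rewrite letter_of_r => [/eqP|]; [exists i | exact: neighbors_in].
by move=> Ai; apply/existsP; exists i; rewrite /= letter_of_r ?Ai //; exact: neighbors_in.
Qed.

Lemma corona_has_1 : has_1 corona_code <-> exists i, radius (A i) = 1.
Proof.
rewrite /corona_code has_1_word_code; split => [/existsP|] [i].
  by rewrite letter_of_1 => [/eqP|]; [exists i | exact: neighbors_in].
by move=> Ai; apply/existsP; exists i; rewrite /= letter_of_1 ?Ai //; exact: neighbors_in.
Qed.

Lemma tangent_sym (C D : circle R) : tangent C D -> tangent D C.
Proof. by rewrite /tangent edistC addrC. Qed.

Lemma corona_edge (k : nat) (a b : letter) : (k < 6)%N -> nth 0%N corona_code k != 0%N ->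
  (forall x y, edge_kind x y = k -> (x, y) = (a, b) \/ (x, y) = (b, a)) ->
  exists i j, [/\ radius (A i) = letter_radius a, radius (A j) = letter_radius b &
    tangent (A i) (A j)].
Proof.
have [[[_ PA _ tanA] _] _ _] := nbA.
move=> k6 /(word_code_gt0 k6) [i ki] /(_ _ _ ki) /= [] [ea eb].
  exists i, (ordS i); split; rewrite -?ea -?eb ?letter_ofK //.
by exists (ordS i), i; split; rewrite -?ea -?eb ?letter_ofK //; apply: tangent_sym.
Qed.

Lemma mem_neighbors (C : circle R) : P C -> tangent S C -> radius S <= radius C ->
  exists i, A i = C.
Proof. by move=> PC SC le; apply: (tangent_mem_neighbors _ nbA PC SC le); case: compP. Qed.

End Corona.

Lemma exists_radius (x : R) : [set s; r; 1] x -> exists2 C, P C & radius C = x.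
Proof. by rewrite -radiiP. Qed.

Let X (p : R -> Prop) : set (circle R) := [set C | P C /\ p (radius C)].

(** A circle of radius 1 serves as the fixed circle of the descent: it is outside of the family and
    no circle of the packing is larger. *)
Lemma exit_corona (p : R -> Prop) (x : R) : [set s; r; 1] x -> p x -> ~ p 1 ->
  exists S m (A : 'I_m -> circle R), [/\ P S, p (radius S), neighbors P S A &
    exists i, ~ p (radius (A i))].
Proof.
move=> /exists_radius [C0 PC0 <-] pC0 np1.
have [C1 PC1 rC1] := exists_radius (or_intror erefl : [set s; r; 1] 1).
have le1 (D : circle R) : P D -> s <= radius D <= radius C1.
  by move=> /radius_cases; rewrite rC1; case=> ->;
    rewrite ?lexx ?(ltW sr) ?(ltW r1) ?(ltW (lt_trans sr r1)).
have XP : X p `<=` P by move=> D [].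
have nX1 : ~ X p C1 by rewrite /X /= rC1 => -[].
have Xle D : X p D -> s <= radius D <= radius C1 by case=> PD _; apply: le1.
have [S [[PS pS] [m [A [nbA [i nXA]]]]]] :=
  exists_neighbor_outside compP XP (conj PC0 pC0) PC1 nX1 s0 Xle.
exists S, m, A; split => //; exists i => pA; apply: nXA; split => //.
exact: (neighbors_in nbA).
Qed.

Lemma exists_compatible_codes :
  exists ck, realizes ck (r, s) /\ compatible ck.1 ck.2.
Proof.
have sS : [set s; r; 1] s by left; left.
have rS : [set s; r; 1] r by left; right.
have s_lt1 : s < 1 := lt_trans sr r1.
have nbP : forall C, P C -> exists m (A : 'I_m -> circle R), neighbors P C A by case: compP.
have realizesI (S T : circle R) (m n : nat) (A : 'I_m -> circle R) (B : 'I_n -> circle R) :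
  P S -> P T -> radius S = s -> radius T = r -> neighbors P S A -> neighbors P T B ->
  (exists i, radius (A i) <> s) -> (exists i, radius (B i) <> r) ->
  (exists i, radius (A i) = 1) \/ (exists i, radius (B i) = 1) ->
  realizes (corona_code A, corona_code B) (r, s).
  move=> PS PT eS eT nbA nbB nA nB h1; split; rewrite /=.
  - by split.
  - by split; apply: closed_word_code.
  - case: nA => i nAi; case: (radius_cases (neighbors_in nbA i)) => // e; apply/orP.
      by left; apply/(corona_has_r nbA); exists i.
    by right; apply/(corona_has_1 nbA); exists i.
  - case: nB => i nBi; case: (radius_cases (neighbors_in nbB i)) => // e; apply/orP.
      by left; apply/(corona_has_s nbB); exists i.
    by right; apply/(corona_has_1 nbB); exists i.
  - split; first by apply/orP; case: h1; [left; apply/(corona_has_1 nbA) | right; apply/(corona_has_1 nbB)].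
      by have := corona_code_sum nbA; rewrite eS.
    by have := corona_code_sum nbB; rewrite eT.
(* First case: some r-circle [T] has a neighbor of radius 1. *)
have [[T [n [B [PT rT nbB B1]]]]|no1] := pselect (exists T n (B : 'I_n -> circle R),
    [/\ P T, radius T = r, neighbors P T B & exists i, radius (B i) = 1]).
  have tanT : forall i, tangent T (B i) by have [[[]]] := nbB.
  have PB := neighbors_in nbB.
  have k1 : has_1 (corona_code B) by apply/(corona_has_1 nbB).
  have nB : exists i, radius (B i) <> r.
    by case: B1 => i Bi; exists i; rewrite Bi; apply/eqP; rewrite gt_eqF.
  have [S [m [A [PS rS' nbA [nA [hr h1]]]]]] : exists S m (A : 'I_m -> circle R),
    [/\ P S, radius S = s, neighbors P S A & (exists i, radius (A i) <> s) /\
      ((has_s (corona_code B) -> exists i, radius (A i) = r) /\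
      (nth 0%N (corona_code B) 2 != 0%N -> exists i, radius (A i) = 1))].
    have mem i : radius (B i) = s -> exists m (A : 'I_m -> circle R), neighbors P (B i) A /\
        exists j, A j = T.
      move=> Bi; have [m [A nbA]] := nbP _ (PB i); exists m, A; split => //.
      apply: (mem_neighbors nbA) => //; first exact: tangent_sym.
      by rewrite Bi rT ltW.
    (* A pair s1 in the code of [T] yields an s-circle touching both [T] and a 1-circle; both are
       larger, hence among its neighbors. *)
    have [z2|nz2] := eqVneq (nth 0%N (corona_code B) 2) 0%N; last first.
      have [|i [j [/= Bi Bj tan_ij]]] := corona_edge (k := 2%N) (a := Ls) (b := L1) nbB isT nz2.
        by case; case => // _; auto.
      have [m [A [nbA [i' Ai']]]] := mem i Bi.
      have [|j' Aj'] := mem_neighbors nbA (PB j) tan_ij.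
        by rewrite Bi Bj ltW.
      exists (B i), m, A; split => //; split; last split => _.
      + by exists i'; rewrite Ai' rT; apply/eqP; rewrite gt_eqF.
      + by exists i'; rewrite Ai'.
      + by exists j'; rewrite Aj'.
    have [hs|nhs] := boolP (has_s (corona_code B)).
      have [i Bi] := (corona_has_s nbB).1 hs.
      have [m [A [nbA [i' Ai']]]] := mem i Bi.
      exists (B i), m, A; split => //; split; last split => // _.
      + by exists i'; rewrite Ai' rT; apply/eqP; rewrite gt_eqF.
      + by exists i'; rewrite Ai'.
    (* No neighbor of [T] has radius s: any s-circle with a neighbor of another radius will do. *)
    have [|S [m [A [PS eS nbA nA]]]] := exit_corona (p := fun x => x = s) sS erefl.
      by apply/eqP; rewrite gt_eqF.
    by exists S, m, A.
  exists (corona_code A, corona_code B); split.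
    by apply: (realizesI S T) => //; right.
  rewrite -[compatible _ _]/(compatible (corona_code A) (corona_code B)) /compatible k1; apply/andP; split; apply/implyP.
    by move=> /hr h; apply/(corona_has_r nbA).
  by rewrite lt0n => /h1 h; apply/(corona_has_1 nbA).
(* Second case: a circle smaller than 1 with a neighbor of radius 1 has to be an s-circle. *)
have [|S [m [A [PS lS nbA [i Ai]]]]] := exit_corona (p := fun x => x < 1) sS s_lt1.
  by rewrite ltxx.
have A1 : exists i, radius (A i) = 1.
  exists i; case: (radius_cases (neighbors_in nbA i)) => // e.
    by rewrite e in Ai.
  by rewrite e in Ai.
have rS' : radius S = s.
  case: (radius_cases PS) => // e.
    by case: no1; exists S, m, A.
  by rewrite e ltxx in lS.
have [|T [n [B [PT rT nbB nB]]]] := exit_corona (p := fun x => x = r) rS erefl.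
  by apply/eqP; rewrite gt_eqF.
exists (corona_code A, corona_code B); split.
  apply: (realizesI S T) => //; last by left.
  by case: A1 => j Aj; exists j; rewrite Aj; apply/eqP; rewrite gt_eqF.
rewrite -[compatible _ _]/(compatible (corona_code A) (corona_code B)) /compatible.
have -> : has_1 (corona_code B) = false.
  by apply/negP => /(corona_has_1 nbB) B1; apply: no1; exists T, n, B.
apply/andP; split; first by apply/(corona_has_1 nbA).
(* A pair r1 around [S] would make a 1-circle a neighbor of an r-circle, against [no1]. *)
apply/negP => /negP nz4.
have [|a [b [/= Aa Ab tan_ab]]] := corona_edge (k := 4%N) (a := Lr) (b := L1) nbA isT nz4.
  by case; case => // _; auto.
have [n' [B' nbB']] := nbP _ (neighbors_in nbA a).
have [|j Bj] := mem_neighbors nbB' (neighbors_in nbA b) tan_ab.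
  by rewrite Aa Ab ltW.
apply: no1; exists (A a), n', B'; split => //; first exact: (neighbors_in nbA).
by exists j; rewrite Bj.
Qed.

End Packing.

Theorem mainTheorem1 (R : realType) : Pi3 R #<= `I_13617.
Proof.
apply: card_le_code_pairs size_code_pairs _ => -[r s] [s0 sr r1 [P [[compP _] radiiP]]].
exact: exists_compatible_codes s0 sr r1 compP radiiP.
Qed.
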